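(* Let $G$ be a finite quasiprimitive permutation group on $\Omega$. Then either (i) $G$ has a regular subgroup and the EKR property, or (ii) $G$ is an almost simple group or a group of product action type. Moreover, the following hold in connection with case (ii): (a) For every $\varepsilon>0$ there exist infinitely many primitive (nonabelian) simple permutation groups $G\leqslant\mathrm{Sym}(\Omega)$ such that $G=RS$ for some semiregular subgroup $R$ and some maximum intersecting subset $S$ of $G$, and $\frac{\sqrt2}{2}-\varepsilon<\rho(G/\Omega)<\frac{\sqrt2}{2}$. (b) For every integer $\ell\geqslant 2$ and every $\varepsilon>0$ there exist infinitely many primitive groups $G$ in product action on $\Omega=\Delta^\ell$ such that $G=RS$ for some semiregular subgroup $R$ and some maximum intersecting subset $S$ of $G$, and $\left(\frac{\sqrt2}{2}\right)^\ell-\varepsilon<\rho(G/\Omega)<\left(\frac{\sqrt2}{2}\right)^\ell$.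
   Context: A permutation group is quasiprimitive if each of its nontrivial normal subgroups is transitive. For a finite transitive group $G\leqslant\mathrm{Sym}(\Omega)$: a subset $S\subseteq G$ is intersecting if for all $x,y\in S$ the permutation $xy^{-1}$ fixes some point of $\Omega$; it is maximum if it has the largest possible size. $G$ has the EKR property if its point stabilizers $G_\omega$ are maximum intersecting subsets. A subgroup is semiregular if only its identity fixes a point of $\Omega$, and regular if it is semiregular and transitive. $\rho(G/\Omega)=\dfrac{|S|}{|G_\omega|\sqrt{|\Omega|}}$ with $S$ a maximum intersecting subset. $G$ is almost simple if $T\leqslant G\leqslant\mathrm{Aut}(T)$ for some nonabelian finite simple group $T$. A quasiprimitive group $G$ is of product action type (type PA of the O'Nan-Scott-Praeger theorem) if it has a unique minimal normal subgroup $N=T_1\times\cdots\times T_k$ with $k\geqslant2$ and the $T_i$ isomorphic nonabelian simple groups, $N_\omega\neq1$, and the projection of $N_\omega$ into each $T_i$ is a proper subgroup of $T_i$. A primitive group in product action on $\Omega=\Delta^\ell$ is a primitive group of this type that is a subgroup of $\mathrm{Sym}(\Delta)\wr \mathrm{S}_\ell$ acting on $\Delta^\ell$ in its product action: the base group $\mathrm{Sym}(\Delta)^\ell$ acts coordinatewise and $\mathrm{S}_\ell$ permutes the coordinates. *)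

(* Defs.v *)
From mathcomp Require Import all_boot all_order all_algebra all_fingroup.
From mathcomp Require Import all_solvable.
From mathcomp Require Import reals.

Set Implicit Arguments.
Unset Strict Implicit.
Unset Printing Implicit Defensive.

Import Order.TTheory GRing.Theory Num.Theory.

Local Open Scope group_scope.

Section PermGroups.

Variable Omega : finType.
Implicit Types (G N M R : {group {perm Omega}}) (S : {set {perm Omega}}).

(* Transitivity has to be required separately: the trivial group has no
   nontrivial normal subgroup. *)
Definition quasiprimitive G : Prop :=
  [transitive G, on [set: Omega] | 'P] /\
  forall N, N <| G -> N :!=: 1 -> [transitive N, on [set: Omega] | 'P].

Definition intersecting G S : bool :=
  (S \subset G) &&
  [forall x in S, forall y in S, exists w : Omega, (x * y^-1) w == w].

Definition maximum_intersecting G S : Prop :=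
  intersecting G S /\ forall S', intersecting G S' -> #|S'| <= #|S|.

Definition EKR_property G : Prop :=
  forall w : Omega, maximum_intersecting G 'C_G[w | 'P].

Definition semiregular_perm R : Prop :=
  forall g, g \in R -> forall w : Omega, g w = w -> g = 1.

Definition regular_perm R : Prop :=
  semiregular_perm R /\ [transitive R, on [set: Omega] | 'P].

Definition max_intersecting_size G : nat :=
  \max_(S : {set {perm Omega}} | intersecting G S) #|S|.

(* For transitive G the value does not depend on the base point w. *)
Definition rho (K : realType) G (w : Omega) : K :=
  ((max_intersecting_size G)%:R
     / (#|'C_G[w | 'P]|%:R * Num.sqrt #|Omega|%:R))%R.

Definition unique_minimal_normal N G : Prop :=
  [/\ N \subset G, minnormal N G
    & forall M, M \subset G -> minnormal M G -> M = N].

Definition PA_type G : Prop :=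
  quasiprimitive G /\
  exists (k : nat) (N : {group {perm Omega}})
         (T : 'I_k -> {group {perm Omega}}),
  [/\ (2 <= k)%N, unique_minimal_normal N G,
      \big[dprod/1]_(i < k) T i = N,
      (forall i, simple (T i) /\ ~~ abelian (T i))
        /\ (forall i j, T i \isog T j)
    & forall w : Omega,
        'C_N[w | 'P] != 1 /\
        (* remgr H K is the projection of H * K onto K with kernel H *)
        forall i, remgr (\prod_(j < k | j != i) T j)%G (T i) @: 'C_N[w | 'P]
                    \proper T i].

End PermGroups.

(* Inn(T), the image of T under conj_aut T, plays the role of T in Aut(T). *)
Definition almost_simple (gT : finGroupType) (G : {group gT}) : Prop :=
  exists (hT : finGroupType) (T : {group hT}) (H : {group {perm hT}}),
  [/\ simple T, ~~ abelian T, conj_aut T @* T \subset H, H \subset Aut T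
    & G \isog H].

Definition perm_isomorphic (Omega1 Omega2 : finType)
    (G1 : {group {perm Omega1}}) (G2 : {group {perm Omega2}}) : Prop :=
  exists (f : Omega1 -> Omega2) (phi : {morphism G1 >-> {perm Omega2}}),
  [/\ bijective f, isom G1 G2 phi
    & forall g, g \in G1 -> forall w, f (g w) = phi g (f w)].

Section ProductAction.

Variables (Delta : finType) (l : nat).

Definition base_group : {set {perm {ffun 'I_l -> Delta}}} :=
  [set g : {perm {ffun 'I_l -> Delta}} | [exists h : {ffun 'I_l -> {perm Delta}},
            forall x : {ffun 'I_l -> Delta}, g x == [ffun i => h i (x i)]]].

Definition top_group : {set {perm {ffun 'I_l -> Delta}}} :=
  [set g : {perm {ffun 'I_l -> Delta}} | [exists s : 'S_l, forall x : {ffun 'I_l -> Delta}, g x == [ffun i => x (s i)]]].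

Definition product_action_wreath : {set {perm {ffun 'I_l -> Delta}}} :=
  base_group <*> top_group.

Definition primitive_in_product_action
    (G : {group {perm {ffun 'I_l -> Delta}}}) : Prop :=
  [/\ [primitive G, on [set: {ffun 'I_l -> Delta}] | 'P], PA_type G
    & G \subset product_action_wreath].

End ProductAction.

(* Main.v *)
Require Import Defs.
From mathcomp Require Import all_boot all_order all_algebra all_fingroup.
From mathcomp Require Import all_solvable all_field.
From mathcomp Require Import reals.
From mathcomp Require Import ring lra.

Set Implicit Arguments.
Unset Strict Implicit.
Unset Printing Implicit Defensive.

Import Order.TTheory GRing.Theory Num.Theory.

Local Open Scope group_scope.

(** Everything rests on one counting remark. If [R] is a semiregular subgroup
    of [G] and [S] is an intersecting set, then the products [r * s] are
    pairwise distinct, so [#|R| * #|S| <= #|G|]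
    ([semiregular_coclique_bound]). Hence a regular subgroup forces the EKR
    property, and a factorization [G = R * S] makes [S] maximum and gives
    [rho = sqrt #|Omega| / #|R|] ([rho_factorization]).

    The dichotomy. Let [N] be a minimal normal subgroup of a quasiprimitive
    group [G]. If ['C_G(N)] is nontrivial, it is transitive, so [N] is regular.
    Otherwise [N] is nonabelian, it is the only minimal normal subgroup, and it
    is a direct product of isomorphic simple groups [T i]. With a single factor
    [G] embeds in [Aut N] and is almost simple. With several factors, [G] has
    type PA unless [N] is regular or some point stabilizer ['C_N[w]] projects
    onto some [T i]. In the latter case it projects onto all of them
    ([full_projections]), and a subdirect subgroup of a product of simple groups
    has a complement that is a partial product of the factors
    ([subdirect_complement]). This complement is normal in the transitive group
    [N], so it is regular. Thus Scott's description of subdirect subgroups is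
    replaced by a maximality argument on sets of factors.

    The simple examples. Take [q = 2 ^ n >= 4] and let [PGL(2, q) = PSL(2, q)]
    act on the [q (q + 1) / 2] unordered pairs of points of the projective line.
    A Borel subgroup [S] is intersecting: an affine map fixes two points or, in
    characteristic two, is a translation, which swaps [0] and [b]. A Singer
    cycle [R] is regular on the [q + 1] points, and it is semiregular on pairs
    because its order is odd. Since [R] is transitive and [S] is a point
    stabilizer on the line, the group equals [R * S], and
    [rho ^ 2 = q / (2 (q + 1))] increases to [1 / 2]. Simplicity holds because
    the group is perfect while its quotient by a nontrivial normal subgroup
    (transitive on the line) is an image of the metabelian Borel subgroup.

    The product action. For such a [T = R * S] on [Delta], the wreath product
    [T wr S_l] on [Delta ^ l] equals [R ^ l * (S wr S_l)]. Here [R ^ l] is again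
    semiregular, and every element of [S wr S_l] fixes a point because the
    product of its coordinates along each cycle lies in [S] and so fixes a point
    of [Delta] ([wreath_fixed_point]). So [rho] is raised to the power [l].
    Primitivity and the structure of the socle are read off from commutators
    with permutations of a single coordinate. *)

(** * Intersecting sets and semiregular subgroups *)

Section Coclique.
Variable Omega : finType.
Implicit Types (G R N : {group {perm Omega}}) (S : {set {perm Omega}}).

Lemma mul_card_leq (gT : finGroupType) (A B : {set gT}) : (#|(A * B)%g| <= #|A| * #|B|)%N.
Proof. by rewrite -cardsX /mulg /= /set_mulg curry_imset2X leq_imset_card. Qed.

Lemma intersectingP G S :
  reflect (S \subset G /\
           forall x y, x \in S -> y \in S -> exists w : Omega, (x * y^-1) w = w)
          (intersecting G S).
Proof.
apply: (iffP andP) => -[sSG]; last first.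
  move=> h; split=> //; apply/forall_inP=> x Sx; apply/forall_inP=> y Sy.
  by have [w hw] := h x y Sx Sy; apply/existsP; exists w; apply/eqP.
move/forall_inP=> h; split=> // x y Sx Sy.
by have /forall_inP/(_ y Sy)/existsP[w /eqP hw] := h x Sx; exists w.
Qed.

Lemma in_stab G w g : (g \in 'C_G[w | 'P]) = (g \in G) && (g w == w).
Proof. by rewrite inE; congr andb; apply/astab1P/eqP. Qed.

(** If [r * s = r' * s'], then [s * s'^-1 = r^-1 * r'] is an element of [R] with
    a fixed point, hence trivial. *)
Lemma semiregular_coclique_bound G R S :
  R \subset G -> semiregular_perm R -> intersecting G S ->
  (#|R| * #|S| <= #|G|)%N.
Proof.
move=> sRG srR /intersectingP[sSG intS].
rewrite -cardsX.
have inj: {in setX R S &, injective (fun p : {perm Omega} * {perm Omega} => p.1 * p.2)}.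
  move=> [r s] [r' s'] /setXP[/= Rr Ss] /setXP[/= Rr' Ss'] /= eq_rs.
  have e1: s * s'^-1 = r^-1 * r'.
    apply: (mulgI r); apply: (mulIg s').
    by rewrite -!mulgA mulVg mulg1 mulKVg.
  have [w] := intS s s' Ss Ss'; rewrite e1 => fix_w.
  have e2: r^-1 * r' = 1 by apply: srR fix_w; rewrite groupM ?groupV.
  have -> : r = r' by rewrite -[r']mul1g -(mulgV r) -mulgA e2 mulg1.
  by congr (_, _); apply/eqP; rewrite eq_mulgV1 e1 e2.
rewrite -(card_in_imset inj); apply: subset_leq_card.
apply/subsetP=> _ /imsetP[[r s] /setXP[/= Rr Ss] ->].
by apply: groupM; [apply: (subsetP sRG) | apply: (subsetP sSG)].
Qed.

Lemma point_stabilizer_intersecting G w : intersecting G 'C_G[w | 'P].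
Proof.
apply/intersectingP; split=> [|x y]; first exact: subsetIl.
move=> Cx Cy; exists w; have: x * y^-1 \in 'C_G[w | 'P] by rewrite groupM ?groupV.
by rewrite in_stab => /andP[_ /eqP].
Qed.

Lemma regular_card R (w : Omega) : regular_perm R -> #|R| = #|Omega|.
Proof.
case=> srR trR; rewrite -cardsT -(atransP trR w (in_setT w)) card_orbit.
suff -> : 'C_R[w | 'P] = 1 by rewrite indexg1.
apply/trivgP/subsetP=> g; rewrite in_stab => /andP[Rg /eqP fix_w].
by apply/set1P; apply: srR fix_w.
Qed.

Lemma transitive_card_stab G (w : Omega) :
  [transitive G, on [set: Omega] | 'P] -> (#|Omega| * #|'C_G[w | 'P]|)%N = #|G|.
Proof.
by move=> trG; rewrite -cardsT -(atransP trG w (in_setT w)) card_orbit_stab.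
Qed.

(** The bound obtained from a regular subgroup is [#|G| / #|Omega|], which is the
    order of a point stabilizer. *)
Lemma regular_EKR G R :
  [transitive G, on [set: Omega] | 'P] -> R \subset G -> regular_perm R ->
  EKR_property G.
Proof.
move=> trG sRG regR w; split=> [|S' intS']; first exact: point_stabilizer_intersecting.
have := semiregular_coclique_bound sRG (proj1 regR) intS'.
rewrite (regular_card w regR) -(transitive_card_stab w trG) leq_pmul2l //.
by apply/card_gt0P; exists w.
Qed.

Lemma factorization_maximum G R S :
  R \subset G -> semiregular_perm R -> intersecting G S -> G = R * S :> {set _} ->
  maximum_intersecting G S.
Proof.
move=> sRG srR intS defG; split=> // S' intS'.
rewrite -(leq_pmul2l (cardG_gt0 R)).
apply: leq_trans (semiregular_coclique_bound sRG srR intS') _.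
rewrite defG; exact: mul_card_leq.
Qed.

Lemma maximum_intersecting_size G S :
  maximum_intersecting G S -> max_intersecting_size G = #|S|.
Proof.
case=> intS maxS; apply/eqP; rewrite eqn_leq; apply/andP; split.
  by apply/bigmax_leqP.
exact: (@leq_bigmax_cond _ (intersecting G) (fun S => #|S|)).
Qed.

(** Both [#|R| * #|S|] and [#|Omega| * #|'C_G[w]|] equal [#|G|], so that
    [#|S| / #|'C_G[w]| = #|Omega| / #|R|]. *)
Lemma rho_factorization (K : realType) G R S (w : Omega) :
  [transitive G, on [set: Omega] | 'P] -> R \subset G -> semiregular_perm R ->
  intersecting G S -> G = R * S :> {set _} ->
  rho K G w = (Num.sqrt #|Omega|%:R / #|R|%:R)%R.
Proof.
move=> trG sRG srR intS defG; rewrite /rho.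
rewrite (maximum_intersecting_size (factorization_maximum sRG srR intS defG)).
have eRS: (#|R| * #|S| = #|Omega| * #|'C_G[w | 'P]|)%N.
  rewrite (transitive_card_stab w trG); apply/eqP; rewrite eqn_leq.
  rewrite (semiregular_coclique_bound sRG srR intS) defG; exact: mul_card_leq.
have Om0: (0 < #|Omega|)%N by apply/card_gt0P; exists w.
have s0: (Num.sqrt (#|Omega|%:R : K) != 0)%R by rewrite sqrtr_eq0 -ltNge ltr0n.
have R0: (#|R|%:R != 0 :> K)%R by rewrite pnatr_eq0 -lt0n cardG_gt0.
have C0: (#|'C_G[w | 'P]|%:R != 0 :> K)%R by rewrite pnatr_eq0 -lt0n cardG_gt0.
apply/eqP; rewrite GRing.eqr_div ?mulf_neq0 //.
by rewrite mulrCA -expr2 sqr_sqrtr ?ler0n // -!natrM mulnC eRS mulnC.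
Qed.
End Coclique.

(** * Subdirect subgroups of direct products of simple groups *)

Section SubdirectComplement.

Variables (gT : finGroupType) (I : finType) (T : I -> {group gT}).
Variable N : {group gT}.
Hypothesis defN : \big[dprod/1]_i T i = N.

Let N_ (J : {set I}) := (\prod_(i in J) T i)%G.

Lemma dprod_factors_cent i j : i != j -> T i \subset 'C(T j).
Proof.
move=> neq_ij; have defNc := bigdprodWcp defN.
have /bigcprodYP : \big[cprod/1]_i T i == (\prod_i T i)%G.
  by rewrite defNc -(bigcprodWY defNc) -bigprodGE.
by apply.
Qed.

Lemma dprod_factor_sub i : T i \subset N.
Proof. by rewrite -(bigdprodWY defN) sub_gen // (bigcup_max i). Qed.

Lemma dprod_factor_normal i : T i <| N.
Proof.
rewrite /normal dprod_factor_sub -(bigdprodWY defN) gen_subG.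
apply/bigcupsP=> j _; have [->|neq_ji] := eqVneq j i; first exact: normG.
exact/cents_norm/dprod_factors_cent.
Qed.

Lemma partial_prod_normal J : N_ J <| N.
Proof.
rewrite /normal /N_ bigprodGE gen_subG; apply/andP; split.
  by apply/bigcupsP=> i _; apply: dprod_factor_sub.
by apply/norms_gen/norms_bigcup/bigcapsP=> i _; case/andP: (dprod_factor_normal i).
Qed.

Lemma dprod_complement_factor i :
  (\prod_(j | j != i) T j)%G \x T i = N.
Proof.
move: defN; rewrite (bigD1 i) //= => defN'.
have [[_ K _ defK] _ _ _] := dprodP defN'.
by rewrite bigprodGE (bigdprodWY defK) dprodC -defN' defK.
Qed.

(** The inclusion [T i \subset H * 'C(T i)] expresses that [H] projects onto
    [T i]; in this form it is visibly stable under conjugation. Choose [J]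
    maximal such that the partial product over [J] meets [H] trivially. For [j]
    outside [J], the intersection [L] of [H] with the partial product over
    [j |: J] is nontrivial, so its projection [A] to [T j] is nontrivial too. As
    [H] normalizes [L] and induces every inner automorphism of [T j], the group
    [A] is normal in [T j], hence equal to it; so [T j] lies in [H] times the
    partial product over [J]. *)
Lemma subdirect_complement (H : {group gT}) :
  (forall i, simple (T i)) -> H \subset N ->
  (forall i, T i \subset H * 'C(T i)) ->
  exists2 R : {group gT}, R <| N & R :&: H = 1 /\ H * R = N.
Proof.
move=> simT sHN surjH.
have: exists J : {set I}, N_ J :&: H \subset [1 gT].
  by exists set0; rewrite /N_ big_set0 subsetIl.
case/ex_maxset=> J /maxsetP[trJ maxJ]; exists (N_ J); first exact: partial_prod_normal.
split; first exact/trivgP.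
have nNJ := partial_prod_normal J; have [sJN nJN] := andP nNJ.
have nJH : H \subset 'N(N_ J) := subset_trans sHN nJN.
apply/eqP; rewrite eqEsubset mul_subG // -{1}(bigdprodWY defN).
rewrite -norm_joinEl // gen_subG; apply/bigcupsP=> j _; rewrite /= norm_joinEl //.
have [Jj | J'j] := boolP (j \in J).
  by apply: subset_trans (mulG_subr _ _); rewrite /N_ bigprodGE sub_gen // (bigcup_max j).
have cTJ : N_ J \subset 'C(T j).
  rewrite /N_ bigprodGE gen_subG; apply/bigcupsP=> i Ji; apply: dprod_factors_cent.
  by apply: contraNneq J'j => <-.
pose L := (H :&: N_ (j |: J))%G.
have nLJ : L \subset 'N(N_ J) by rewrite subIset ?nJH.
have ntL : ~~ (L \subset [1 gT]).
  apply: contra J'j => trL; rewrite -[in X in _ \in X](maxJ (j |: J)) ?subsetUr ?setU11 //.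
  by rewrite setIC.
(* A is the image of L under the projection to T j along N_ J. *)
pose A := (T j :&: (L <*> N_ J))%G.
have defNJ : N_ (j |: J) = (T j <*> N_ J)%G.
  by apply: group_inj; rewrite /N_ big_setU1.
have nTJ : T j \subset 'N(N_ J) by rewrite cents_norm // centsC.
(* A nontrivial x in L is t * n with t in A, and t = 1 would put x in N_ J. *)
have ntA : A :!=: 1.
  have [x /setIP[Hx]] := subsetPn ntL.
  rewrite defNJ /= norm_joinEl // => /mulsgP[t n Tt Nn def_x] ntx.
  apply: contraNneq ntx => A1.
  have At : t \in A.
    rewrite inE Tt /= norm_joinEl //; apply/mulsgP; exists x n^-1; rewrite ?groupV //.
      rewrite inE Hx defNJ /= norm_joinEl // def_x.
      by apply/mulsgP; exists t n.
    by rewrite def_x mulgK.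
  have /set1P t1 : t \in [1 gT] by rewrite -A1.
  apply: (subsetP trJ).
  by rewrite inE Hx def_x t1 mul1g Nn.
have nAT : T j \subset 'N(A).
  apply/subsetP=> t Tt.
  have /mulsgP[h k Hh Kk def_t] := subsetP (surjH j) t Tt.
  have cAk : k \in 'C(A) by apply: subsetP Kk; apply/centS/subsetIl.
  rewrite def_t groupM //; last by apply: subsetP cAk; apply: cent_sub.
  have Nh := subsetP sHN h Hh.
  have nTh : h \in 'N(T j) by apply: subsetP Nh; case/andP: (dprod_factor_normal j).
  have nLh : h \in 'N(L).
    apply: (subsetP (normsI (normG H) (subset_trans sHN _))) => //.
    by case/andP: (partial_prod_normal (j |: J)).
  have nJh := subsetP nJH h Hh.
  by rewrite inE /= conjIg conjYg !(normP _).
have sAT : A <| T j by rewrite /normal subsetIl.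
have [_ simTj] := simpleP _ (simT j).
case: (simTj _ sAT) => [A1 | AT]; first by rewrite A1 eqxx in ntA.
rewrite -AT; apply: subset_trans (subsetIr _ _) _.
by rewrite /= norm_joinEl // mulSg // subsetIl.
Qed.

End SubdirectComplement.

(** * Quasiprimitive groups *)

(** The factors are images of one simple subgroup under automorphisms of [N]; they
    are indexed by an ordinal, as type PA requires. *)
Lemma minnormal_simple_dprod (gT : finGroupType) (N G : {group gT}) :
  minnormal N G ->
  exists k (T : 'I_k -> {group gT}),
    [/\ \big[dprod/1]_(i < k) T i = N, forall i, simple (T i)
      & forall i j, T i \isog T j].
Proof.
move=> minN; have [H [sHN simH [A sAN defN]]] := charsimple_dprod (minnormal_charsimple minN).
have imH (f : {perm gT}) : f \in A -> <<f @: H>> = f @: H /\ H \isog <<f @: H>>.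
  move=> Af; have AutNf := subsetP sAN f Af.
  have -> : f @: H = autm AutNf @* H by rewrite -(autmE AutNf) morphimEsub.
  by rewrite genGid sub_isog // injm_autm.
pose F (f : {perm gT}) : {group gT} := [group of << f @: H >>].
exists #|A|, (fun i => F (@enum_val _ (mem A) i)); split.
- rewrite -defN (big_enum_val (fun f : {perm gT} => f @: H)) /=.
  by apply: eq_bigr => i _; have [-> _] := imH _ (enum_valP i).
- by move=> i; have [_ isoH] := imH _ (enum_valP i); rewrite -(isog_simple isoH).
move=> i j; have [_ isoi] := imH _ (enum_valP i); have [_ isoj] := imH _ (enum_valP j).
by apply: isog_trans isoj; rewrite isog_sym.
Qed.

Section Quasiprimitive.

Variable Omega : finType.
Implicit Types (G N R X : {group {perm Omega}}).

(** The complement [R] is normal in the transitive group [N], so it meets every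
    conjugate of ['C_N[w]], that is, every point stabilizer, trivially. *)
Lemma complement_regular N R (w : Omega) :
  [transitive N, on [set: Omega] | 'P] -> R <| N ->
  R :&: 'C_N[w | 'P] = 1 -> 'C_N[w | 'P] * R = N -> regular_perm R.
Proof.
move=> trN /andP[sRN nRN] trR defN; split; last first.
  by apply/(subgroup_transitiveP (in_setT w) sRN trN).
move=> g Rg v fix_v.
have [n Nn def_v] := atransP2 trN (in_setT w) (in_setT v).
have: g ^ n^-1 \in R :&: 'C_N[w | 'P].
  rewrite inE in_stab memJ_norm ?groupV ?(subsetP nRN) // Rg (subsetP sRN) /=.
    by rewrite conjgE invgK !permM -[n w]def_v fix_v def_v -permM mulgV perm1.
  by rewrite memJ_norm ?groupV // (subsetP nRN).
by rewrite trR => /set1P/eqP; rewrite conjg_eq1 => /eqP.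
Qed.

Lemma cent_transitive_semiregular N R :
  [transitive N, on [set: Omega] | 'P] -> N \subset 'C(R) -> semiregular_perm R.
Proof.
move=> trN cNR g Rg w fix_w; apply/permP=> v; rewrite perm1.
have [n Nn def_v] := atransP2 trN (in_setT w) (in_setT v).
have cng : n * g = g * n by apply: (centP (subsetP cNR n Nn)).
by rewrite def_v /= /aperm -permM cng permM fix_w.
Qed.

(** Consider the normal simple subgroups [X] of [N] onto which ['C_N[w]]
    projects. They are permuted by ['C_G[w]] and normalized by [N], so the group
    [M] that they generate is normal in [G = 'C_G[w] * N], and it is [N] by
    minimality. A factor [T j] that does not occur among them would meet each of
    them trivially, hence would centralize [M = N] and be abelian. *)
Lemma full_projections G N (k : nat) (T : 'I_k -> {group {perm Omega}})
    (w : Omega) (i : 'I_k) :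
  [transitive N, on [set: Omega] | 'P] -> N \subset G -> minnormal N G ->
  \big[dprod/1]_(j < k) T j = N ->
  (forall j, simple (T j) /\ ~~ abelian (T j)) ->
  T i \subset 'C_N[w | 'P] * 'C(T i) ->
  forall j, T j \subset 'C_N[w | 'P] * 'C(T j).
Proof.
move=> trN sNG /mingroupP[/andP[ntN nNG] minN] defN simT full_i j.
pose full X := [&& X <| N, simple X & X \subset 'C_N[w | 'P] * 'C(X)].
have full_conj X g : g \in 'C_G[w | 'P] -> full X -> full (X :^ g)%G.
  rewrite in_stab => /andP[Gg /eqP fix_w] /and3P[nXN simX fullX].
  have nNg := normP (subsetP nNG g Gg).
  have stabJ : 'C_N[w | 'P] :^ g = 'C_N[w | 'P].
    rewrite conjIg nNg; congr (_ :&: _).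
    by rewrite -astab1_act /= /aperm fix_w.
  apply/and3P; split; first by rewrite /= -nNg normalJ.
    by rewrite /= -(isog_simple (conj_isog X g)).
  by rewrite /= -{1}stabJ centJ -conjsMg conjSg.
pose M := << \bigcup_(X : {group {perm Omega}} | full X) X >>%G.
have sMN : M \subset N.
  by rewrite gen_subG; apply/bigcupsP=> X /and3P[/andP[]].
have nMG : G \subset 'N(M).
  have trG : [transitive G, on [set: Omega] | 'P].
    by rewrite (atrans_supgroup sNG trN); apply/actsP=> g _ v; rewrite !inE.
  have /(subgroup_transitiveP (in_setT w) sNG trG) <- := trN.
  rewrite mul_subG //; last first.
    by apply/norms_gen/norms_bigcup/bigcapsP=> X /and3P[/andP[]].
  apply/norms_gen/subsetP=> g Cg; rewrite inE.
  apply/subsetP=> _ /imsetP[x /bigcupP[X fX Xx] ->].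
  by apply/bigcupP; exists (X :^ g)%G; [exact: full_conj | rewrite memJ_conjg].
have full_sub X : full X -> X \subset M.
  by move=> fX; rewrite sub_gen // (bigcup_max X).
have fi : full (T i) by rewrite /full (dprod_factor_normal defN) full_i (simT i).1.
have defM : M :=: N.
  apply: minN => //; rewrite nMG andbT -subG1.
  apply: contra (simT i).2 => trM; apply: abelianS (abelian1 _).
  exact: subset_trans (full_sub _ fi) trM.
apply: contraR (simT j).2 => nfull_j.
have cTM : M \subset 'C(T j).
  rewrite gen_subG; apply/bigcupsP=> X fX; have [nXN simX fullX] := and3P fX.
  have nTN := dprod_factor_normal defN j.
  have ntX := proj1 (simpleP _ simX).
  have nsXT : X :&: T j <| N by apply: normalI.
  have [_ simX'] := simpleP _ simX; have [_ simT'] := simpleP _ (simT j).1.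
  have [XT1 | XTX] := simX' _ (normalS (subsetIl _ _) (normal_sub nXN) nsXT).
    apply/commG1P/trivgP; rewrite -XT1 subsetI.
    rewrite commg_subl commg_subr.
    apply/andP; split; first exact: subset_trans (normal_sub nTN) (normal_norm nXN).
    exact: subset_trans (normal_sub nXN) (normal_norm nTN).
  have sXT : X \subset T j by rewrite -XTX subsetIr.
  have [X1 | defX] := simT' _ (normalS sXT (normal_sub nTN) nXN).
    by rewrite X1 eqxx in ntX.
  by rewrite -defX fullX in nfull_j.
by rewrite /abelian (subset_trans (dprod_factor_sub defN j)) // -defM.
Qed.


(** Conjugation embeds [G] into [Aut N] as soon as ['C_G(N)] is trivial. *)
Lemma cent1_almost_simple G N :
  simple N -> ~~ abelian N -> N <| G -> 'C_G(N) = 1 -> almost_simple G.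
Proof.
move=> simN nabN /andP[sNG nNG] cGN.
exists ({perm Omega} : finGroupType), N, (conj_aut N @* G)%G; split=> //; first exact: morphimS.
  exact: Aut_conj_aut.
have injf : 'injm (restrm nNG (conj_aut N)).
  by rewrite ker_restrm ker_conj_aut cGN.
by rewrite -[(_ @* G)%G : {set _}](im_restrm nNG) sub_isog.
Qed.

Theorem quasiprimitive_dichotomy G :
  quasiprimitive G ->
  (exists2 R : {group {perm Omega}}, R \subset G & regular_perm R)
  \/ (almost_simple G \/ PA_type G).
Proof.
move=> qpG; have [trG trN_] := qpG.
have [G1 | ntG] := eqVneq (G :> {set _}) 1.
  left; exists G => //; split=> // g; rewrite G1 => /set1P -> //.
have [N minN sNG] := minnormal_exists ntG (normG G).
have [/andP[ntN nNG] minN'] := mingroupP minN.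
have nsNG : N <| G by apply/andP.
have trN := trN_ N nsNG ntN.
have [cN1 | ntC] := eqVneq 'C_G(N) 1; last first.
  left; exists N => //; split=> //.
  apply: (cent_transitive_semiregular (N := 'C_G(N)%G)); last by rewrite subsetIr.
  apply: trN_ ntC; rewrite /normal subsetIl normsI ?normG //=.
  by apply: norms_cent.
have nabN : ~~ abelian N.
  apply: contra ntN => cNN; rewrite -subG1 -cN1 subsetI sNG; exact: cNN.
have umN : unique_minimal_normal N G.
  split=> // M sMG minM; have [/andP[ntM nMG] minM'] := mingroupP minM.
  have [NM1 | ntNM] := eqVneq (N :&: M) 1.
    case/negP: ntM; rewrite -subG1 -cN1 subsetI sMG /=.
    apply/commG1P/trivgP; rewrite -NM1 subsetI commg_subl commg_subr.
    by rewrite (subset_trans sMG nNG) (subset_trans sNG nMG).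
  have nNM : G \subset 'N(N :&: M) by apply: normsI.
  apply/group_inj; transitivity (N :&: M).
    by apply/esym/minM'; rewrite ?subsetIr // ntNM.
  by apply: minN'; rewrite ?subsetIl // ntNM.
have [k [T [defN simT isoT]]] := minnormal_simple_dprod minN.
have nabT i : ~~ abelian (T i).
  apply: contra nabN => abT.
  have abT' j : abelian (T j) by rewrite (isog_abelian (isoT j i)).
  rewrite -(bigdprodWY defN) abelian_gen; apply/centsP.
  move=> x /bigcupP[i' _ Tx] y /bigcupP[j _ Ty].
  have [eqij | neq_ij] := eqVneq i' j; last first.
    exact: (centsP (dprod_factors_cent defN neq_ij)).
  by apply: (centsP (abT' j)) => //; rewrite -eqij.
(* With a single factor N is simple; no factor at all would make N trivial. *)
have [k2 | k1] := leqP 2 k; last first.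
  right; left; case: k k1 T defN simT isoT nabT => [|[|//]] _ T defN simT isoT nabT.
    by rewrite big_ord0 in defN; rewrite -defN eqxx in ntN.
  have eqTN : T ord0 :=: N by move: defN; rewrite big_ord1.
  by apply: cent1_almost_simple nsNG cN1; rewrite -eqTN.
pose K_ i := (\prod_(j < k | j != i) T j)%G.
pose properb w := [forall i, remgr (K_ i) (T i) @: 'C_N[w | 'P] \proper T i].
have [allw | ] := boolP [forall w, ('C_N[w | 'P] != 1) && properb w].
  right; right; split=> //; exists k, N, T; split=> //.
  move=> w; have /andP[ntw /forallP prw] := forallP allw w.
  by split.
rewrite negb_forall => /existsP[w]; rewrite negb_and negbK => nw.
have [stab1 | ntstab] := eqVneq 'C_N[w | 'P] 1.
  left; exists N => //; apply: (complement_regular (w := w) trN (normal_refl N)).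
    by rewrite stab1 (setIidPr (sub1G _)).
  by rewrite stab1 mul1g.
rewrite (negPf ntstab) /= negb_forall in nw; have [i nproper] := existsP nw.
left; have dN := dprod_complement_factor defN i.
(* The kernel of the projection to T i is K_ i, which centralizes T i. *)
have full_i : T i \subset 'C_N[w | 'P] * 'C(T i).
  have [_ defKT cKT trKT] := dprodP dN.
  have sim : remgr (K_ i) (T i) @: 'C_N[w | 'P] \subset T i.
    apply/subsetP=> _ /imsetP[h /setIP[Nh _] ->].
    by apply: mem_remgr; rewrite defKT.
  rewrite properE sim /= negbK in nproper.
  apply/subsetP=> t; rewrite -groupV => /(subsetP nproper)/imsetP[h Ch def_t].
  have Nh := subsetP (subsetIl _ _) h Ch.
  apply/mulsgP; exists h^-1 (divgr (K_ i) (T i) h); first by rewrite groupV.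
    rewrite -defKT in Nh; apply: (subsetP _ _ (mem_divgr Nh)).
    by rewrite centsC in cKT *.
  by rewrite /divgr -def_t invgK mulKg.
have full := full_projections trN sNG minN defN (fun j => conj (simT j) (nabT j)) full_i.
have [R nsRN [trR defR]] := subdirect_complement defN simT (subsetIl _ _) full.
exists R; first exact: subset_trans (normal_sub nsRN) sNG.
exact: complement_regular trN nsRN trR defR.
Qed.

End Quasiprimitive.

(** * Moebius transformations in characteristic two *)

Section Moebius.

Variable F : finFieldType.
Local Notation P := (option F).
Local Notation matrix2 := (F * F * F * F)%type.
Local Open Scope ring_scope.

(** The point with homogeneous coordinates [x : y]; the projective line is
    [option F], with [None] the point at infinity. *)
Definition homog (x y : F) : P := if y == 0 then None else Some (x / y).

Definition det2 (m : matrix2) : F :=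
  let '(a, b, c, d) := m in a * d - b * c.

Definition mob (m : matrix2) (z : P) : P :=
  let '(a, b, c, d) := m in
  if z is Some x then homog (a * x + b) (c * x + d) else homog a c.

Lemma homog_scale k x y : k != 0 -> homog (k * x) (k * y) = homog x y.
Proof.
move=> k0; rewrite /homog mulf_eq0 (negPf k0) /=; case: eqP => // /eqP y0.
by congr Some; field; rewrite k0 y0.
Qed.

Lemma mob_homog a b c d x y : (x != 0) || (y != 0) ->
  mob (a, b, c, d) (homog x y) = homog (a * x + b * y) (c * x + d * y).
Proof.
rewrite {1}/homog; have [-> | y0] /= := eqVneq y 0.
  by rewrite orbF => x0; rewrite !mulr0 !addr0 ![_ * x]mulrC homog_scale.
move=> _; rewrite -(homog_scale (a * (x / y) + b) _ y0); congr homog; field => //.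
Qed.

(** An invertible matrix maps nonzero vectors to nonzero vectors; thus the
    homogeneous coordinates stay legitimate under composition. *)
Lemma det2_row a b c d x y : det2 (a, b, c, d) != 0 -> (x != 0) || (y != 0) ->
  (a * x + b * y != 0) || (c * x + d * y != 0).
Proof.
move=> det0; apply: contraTT; rewrite !negb_or !negbK => /andP[/eqP e1 /eqP e2].
have ex : (a * d - b * c) * x = d * (a * x + b * y) - b * (c * x + d * y) by ring.
have ey : (a * d - b * c) * y = a * (c * x + d * y) - c * (a * x + b * y) by ring.
move: ex ey; rewrite e1 e2 !mulr0 subrr => /eqP ex /eqP ey.
by move: ex ey; rewrite !mulf_eq0 (negPf det0) /= => -> ->.
Qed.

Lemma mob_comp a b c d a' b' c' d' z : det2 (a, b, c, d) != 0 ->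
  mob (a', b', c', d') (mob (a, b, c, d) z) =
  mob (a' * a + b' * c, a' * b + b' * d, c' * a + d' * c, c' * b + d' * d) z.
Proof.
move=> det0; case: z => [x|].
  have nz := @det2_row a b c d x 1 det0; rewrite !mulr1 oner_eq0 orbT in nz.
  have -> : mob (a, b, c, d) (Some x) = homog (a * x + b) (c * x + d) by [].
  by rewrite mob_homog ?nz //=; congr homog; ring.
have nz := @det2_row a b c d 1 0 det0; rewrite !mulr1 !mulr0 !addr0 oner_eq0 in nz.
have -> : mob (a, b, c, d) None = homog a c by [].
by rewrite mob_homog ?nz.
Qed.

Lemma mob_scalar a z : a != 0 -> mob (a, 0, 0, a) z = z.
Proof.
move=> a0; case: z => [x|] /=; rewrite /homog ?eqxx //.
by rewrite mul0r add0r (negPf a0) addr0 mulrAC mulfV // mul1r.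
Qed.

Lemma mob_inj m : det2 m != 0 -> injective (mob m).
Proof.
move: m => [[[a b] c] d] det0; apply: (can_inj (g := mob (d, - b, - c, a))) => z.
rewrite mob_comp // -[RHS](mob_scalar z det0) /det2; congr mob.
by congr (_, _, _, _); ring.
Qed.

Definition moebius_set : {set {perm P}} :=
  [set g : {perm P} | [exists m : matrix2, (det2 m != 0) && [forall z, g z == mob m z]]].

Lemma moebiusP (g : {perm P}) :
  reflect (exists2 m, det2 m != 0 & g =1 mob m) (g \in moebius_set).
Proof.
rewrite inE; apply: (iffP existsP) => [[m /andP[det0 /forallP gm]] | [m det0 gm]].
  by exists m => // z; apply/eqP.
by exists m; rewrite det0; apply/forallP=> z; rewrite gm.
Qed.

Lemma moebius_group_set : group_set moebius_set.
Proof.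
apply/group_setP; split=> [|g h].
  apply/moebiusP; exists (1, 0, 0, 1) => [|z]; first by rewrite /det2 mulr1 mulr0 subr0 oner_eq0.
  by rewrite perm1 mob_scalar // oner_eq0.
case/moebiusP=> [[[[a b] c] d] det0 gm] /moebiusP[[[[a' b'] c'] d'] det0' hm].
apply/moebiusP.
exists (a' * a + b' * c, a' * b + b' * d, c' * a + d' * c, c' * b + d' * d).
  have -> : det2 (a' * a + b' * c, a' * b + b' * d, c' * a + d' * c, c' * b + d' * d) =
    det2 (a', b', c', d') * det2 (a, b, c, d) by rewrite /det2; ring.
  by rewrite mulf_neq0.
by move=> z; rewrite permM hm gm mob_comp.
Qed.
Canonical moebius_group := Group moebius_group_set.
Local Notation G := moebius_group.

Definition mperm (m : matrix2) : {perm P} :=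
  if (det2 m != 0) =P true is ReflectT det0 then perm (mob_inj det0) else 1%g.

Lemma mpermE m z : det2 m != 0 -> mperm m z = mob m z.
Proof. by move=> det0; rewrite /mperm; case: eqP => // ?; rewrite permE. Qed.

Lemma mperm_in m : det2 m != 0 -> mperm m \in G.
Proof. by move=> det0; apply/moebiusP; exists m => // z; rewrite mpermE. Qed.

Definition affine (a b : F) : {perm P} := mperm (a, b, 0, 1).
Arguments affine (a b)%_R.
Definition flip : {perm P} := mperm (0, 1, 1, 0).

Lemma affine_det a b : a != 0 -> det2 (a, b, 0, 1) != 0.
Proof. by rewrite /det2 mulr1 mulr0 subr0. Qed.

Lemma affine_in a b : a != 0 -> affine a b \in G.
Proof. by move=> a0; rewrite mperm_in ?affine_det. Qed.

Lemma affine_inf a b : a != 0 -> affine a b None = None.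
Proof. by move=> a0; rewrite mpermE ?affine_det //= /homog eqxx. Qed.

Lemma affineE a b x : a != 0 -> affine a b (Some x) = Some (a * x + b).
Proof.
by move=> a0; rewrite mpermE ?affine_det //= /homog mul0r add0r oner_eq0 divr1.
Qed.

Lemma flip_det : det2 (0, 1, 1, 0) != 0.
Proof. by rewrite /det2 mulr0 mulr1 sub0r oppr_eq0 oner_eq0. Qed.

Lemma flip_in : flip \in G.
Proof. exact/mperm_in/flip_det. Qed.

Lemma flip_inf : flip None = Some 0.
Proof. by rewrite mpermE ?flip_det //= /homog oner_eq0 mul0r. Qed.

Lemma flip0 : flip (Some 0) = None.
Proof. by rewrite mpermE ?flip_det //= /homog mulr0 addr0 eqxx. Qed.

Lemma flipE x : x != 0 -> flip (Some x) = Some (x^-1).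
Proof.
by move=> x0; rewrite mpermE ?flip_det //= /homog mul0r add0r mul1r addr0 (negPf x0) mul1r.
Qed.

Lemma stab_inf_affine (g : {perm P}) : g \in G -> g None = None ->
  exists a b, a != 0 /\ g = affine a b.
Proof.
case/moebiusP=> [[[[a b] c] d] det0 gm]; rewrite gm /= /homog.
have [c0 _ | //] := eqVneq c 0; rewrite {}c0 {c} in det0 gm.
have: a * d != 0 by move: det0; rewrite /det2 mulr0 subr0.
rewrite mulf_eq0 negb_or => /andP[a0 d0].
have ad0 : a / d != 0 by rewrite mulf_neq0 ?invr_eq0.
exists (a / d), (b / d); split=> //; apply/permP=> -[x|].
  rewrite gm affineE //= /homog mul0r add0r (negPf d0); congr Some; field => //.
by rewrite gm affine_inf //= /homog eqxx.
Qed.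

Lemma affine_comp a b c d : a != 0 -> c != 0 ->
  (affine a b * affine c d)%g = affine (c * a) (c * b + d).
Proof.
move=> a0 c0; have ca0 : c * a != 0 by rewrite mulf_neq0.
apply/permP=> -[x|]; rewrite permM ?affine_inf // !affineE //.
by congr Some; ring.
Qed.


(** The columns of the matrix are homogeneous coordinates of [p] and [q]; it is
    invertible because the points differ. *)
Lemma moebius_two_transitive_inf0 (p q : P) : p != q ->
  exists2 g, g \in G & g None = p /\ g (Some 0) = q.
Proof.
have [one0 zero0] := (oner_neq0 F, eqxx (0 : F)).
case: p q => [x|] [y|] // neq.
- have det0 : det2 (x, y, 1, 1) != 0.
    by rewrite /det2 !mulr1 subr_eq0; apply: contraNneq neq => ->.
  exists (mperm (x, y, 1, 1)); rewrite ?mperm_in // !mpermE //=.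
  by rewrite /homog !mulr0 !add0r oner_eq0 !divr1.
- have det0 : det2 (x, 1, 1, 0) != 0 by rewrite /det2 mulr0 mulr1 sub0r oppr_eq0.
  exists (mperm (x, 1, 1, 0)); rewrite ?mperm_in // !mpermE //=.
  by rewrite /homog !mulr0 !add0r oner_eq0 eqxx !divr1.
- have det0 : det2 (1, y, 0, 1) != 0 by rewrite /det2 mulr0 mulr1 subr0.
  exists (mperm (1, y, 0, 1)); rewrite ?mperm_in // !mpermE //=.
  by rewrite /homog !mulr0 !add0r oner_eq0 eqxx !divr1.
Qed.

Lemma moebius_two_transitive (p q p' q' : P) : p != q -> p' != q' ->
  exists2 g, g \in G & g p = p' /\ g q = q'.
Proof.
case/moebius_two_transitive_inf0=> g Gg [gp gq].
case/moebius_two_transitive_inf0=> h Gh [hp hq].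
exists (g^-1 * h)%g; first by rewrite groupM ?groupV.
by rewrite !permM -gp -gq !permK.
Qed.

(** An element of [N] moves some point [x]; by double transitivity it has a
    conjugate moving [None] to any prescribed other point. *)
Lemma moebius_normal_transitive (N : {group {perm P}}) : N <| G -> N :!=: 1%g ->
  forall p : P, exists2 n, n \in N & n None = p.
Proof.
case/andP=> sNG nNG ntN p.
have [-> | np] := eqVneq p None; first by exists 1%g; rewrite ?group1 ?perm1.
have [n Nn nt] := trivgPn _ ntN.
have [x nx] : exists x, x != n x.
  apply/existsP; apply: contraR nt; rewrite negb_exists => /forallP fixn.
  by apply/eqP/permP=> x; rewrite perm1; have := fixn x; rewrite negbK => /eqP <-.
rewrite eq_sym in np.
have [g Gg [gx gnx]] := moebius_two_transitive nx np.
exists (n ^ g)%g; first by rewrite memJ_norm // (subsetP nNG).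
by rewrite conjgE !permM -gx permK gnx.
Qed.

Definition borel : {group {perm P}} := 'C_G[None | 'P]%G.

Lemma borelP (g : {perm P}) :
  reflect (exists a b, a != 0 /\ g = affine a b) (g \in borel).
Proof.
rewrite in_stab; apply: (iffP andP) => [[Gg /eqP g0] | [a [b [a0 ->]]]].
  exact: stab_inf_affine.
by rewrite affine_in // affine_inf.
Qed.


Lemma affine_commutator a b c d : a != 0 -> c != 0 ->
  [~ affine a b, affine c d]%g = affine 1 ((c * b + d) - (a * d + b)).
Proof.
move=> a0 c0; apply: (mulgI (affine c d * affine a b)%g).
rewrite -commgC !affine_comp ?mulf_neq0 ?oner_neq0 // mul1r mulrC.
by congr affine; ring.
Qed.

(** Commutators of affine maps are translations, and translations commute. *)
Lemma borel_metabelian : (borel^`(2) = 1)%g.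
Proof.
rewrite dergSn; apply/commG1P; rewrite -/(abelian _) abelian_gen; apply/centsP.
move=> _ /imset2P[_ _ /borelP[a [b [a0 ->]]] /borelP[c [d [c0 ->]]] ->].
move=> _ /imset2P[_ _ /borelP[a' [b' [a0' ->]]] /borelP[c' [d' [c0' ->]]] ->].
by rewrite !affine_commutator // /commute !affine_comp ?oner_neq0 // !mul1r addrC.
Qed.

Variable f : nat.
Hypothesis cardF : #|F| = (2 ^ f.+2)%N.

Let char2 : 2%N \in [pchar F] := card_finPcharP cardF isT.
Let big : (2 < #|F|)%N.
Proof. by rewrite cardF (@ltn_exp2l 2 1). Qed.

(** Squaring is the Frobenius endomorphism, which is injective. *)
Lemma square_surj (a : F) : exists t, t ^+ 2 = a.
Proof.
have inj : injective (fun t : F => t ^+ 2).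
  move=> x y /= eq_sq; apply/eqP; rewrite -subr_eq0.
  have: (x - y) ^+ 2 == 0; last by rewrite expf_eq0.
  by apply/eqP; have := pFrobenius_autB_comm char2 (mulrC x y); rewrite !pFrobenius_autE eq_sq subrr.
by have [sqr _ sqrK] := injF_bij inj; exists (sqr a).
Qed.

Lemma exists_not01 : exists c : F, (c != 0) && (c != 1).
Proof.
apply/existsP; apply: contraLR big; rewrite negb_exists -leqNgt => /forallP no.
have card01 : #|[set 0; 1 : F]| = 2%N by rewrite cards2 eq_sym oner_neq0.
rewrite -[leqRHS]card01 -cardsT.
apply: subset_leq_card; apply/subsetP=> x _; rewrite !inE.
by have := no x; rewrite negb_and !negbK.
Qed.

(** The Borel subgroup is a point stabilizer, so only transitivity on the line
    is missing. *)
Lemma sub_borel_transitive (M : {group {perm P}}) : M \subset G ->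
  borel \subset M -> (forall p : P, exists2 n, n \in M & n None = p) -> M :=: G.
Proof.
move=> sMG sBM trM; apply/eqP; rewrite eqEsubset sMG; apply/subsetP=> g Gg.
have [n Mn np] := trM (g None).
rewrite -(groupMr _ (groupVr Mn)); apply: (subsetP sBM).
have Gn := subsetP sMG n Mn.
by rewrite in_stab groupM ?groupV //= permM -np permK.
Qed.

Lemma affine_split a b : a != 0 -> affine a b = (affine a 0 * affine 1 b)%g.
Proof. by move=> a0; rewrite affine_comp ?oner_neq0 // !mul1r add0r. Qed.

Lemma flip_affine a : a != 0 -> (affine a 0 ^ flip = affine a^-1 0)%g.
Proof.
move=> a0; have aV0 : a^-1 != 0 by rewrite invr_eq0.
rewrite conjgE; apply: (mulgI flip); rewrite mulKVg; apply/permP=> z.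
rewrite !permM; case: z => [x|]; last first.
  by rewrite affine_inf // flip_inf affineE // mulr0 addr0.
have [-> | x0] := eqVneq x 0.
  by rewrite flip0 affine_inf // affineE // mulr0 addr0 flip0.
rewrite affineE // addr0 !flipE ?mulf_neq0 // affineE // addr0.
by rewrite invfM.
Qed.

(** The translation by [b] is a commutator of affine maps once some [c] differs
    from [0] and [1]; as the flip inverts the torus, the square [t ^- 2] is a
    commutator too, and every scalar is a square. So the derived subgroup
    contains the Borel subgroup, and it is transitive because it is normal. *)
Lemma moebius_perfect : (G^`(1) = G)%g.
Proof.
have one0 : (1 : F) != 0 := oner_neq0 F.
have [c /andP[c0 c1]] := exists_not01.
have c10 : c - 1 != 0 by rewrite subr_eq0.
have transl b : affine 1 b \in G^`(1)%g.
  have -> : affine 1 b = [~ affine 1 (b / (c - 1)), affine c 0]%g.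
    by rewrite affine_commutator //; congr affine; field.
  by rewrite mem_commg ?affine_in.
have tor a : a != 0 -> affine a 0 \in G^`(1)%g.
  move=> a0; have [t def_t] := square_surj a^-1.
  have t0 : t != 0.
    by apply: contraNneq a0 => t0; rewrite -invr_eq0 -def_t t0 expr0n.
  have -> : affine a 0 = [~ affine t 0, flip]%g.
    rewrite commgEl flip_affine //; apply: (mulgI (affine t 0)); rewrite mulKVg.
    rewrite !affine_comp // !mulr0 addr0 -[a]invrK -def_t.
    by congr affine; field.
  by rewrite mem_commg ?affine_in ?flip_in.
apply: (@sub_borel_transitive (G^`(1))%G); first exact: der_sub.
  apply/subsetP=> _ /borelP[a [b [a0 ->]]].
  by rewrite affine_split // groupM ?transl ?tor.
apply: moebius_normal_transitive; first exact: der_normal.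
apply/trivgPn; exists (affine 1 1); first exact: transl.
apply/eqP=> /permP/(_ (Some 0)); rewrite affineE // perm1 mulr0 add0r => -[].
exact/eqP.
Qed.

(** A nontrivial normal subgroup [N] is transitive on the line, so
    [G = N * borel] and [G / N] is an image of the metabelian Borel subgroup. As
    [G] is perfect, the quotient is trivial. *)
Lemma moebius_simple : simple G.
Proof.
have ntG : G :!=: 1%g.
  by apply/trivgPn; exists flip; [exact: flip_in | apply/eqP=> /permP/(_ None); rewrite flip_inf perm1].
apply/simpleP; split=> // N nsNG.
have [N1 | ntN] := eqVneq (N :> {set _}) 1%g; [by left | right].
have [sNG nNG] := andP nsNG.
have defG : (N * borel)%g = G.
  apply/eqP; rewrite eqEsubset mul_subG // ?subsetIl //; apply/subsetP=> g Gg.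
  have [n Nn np] := moebius_normal_transitive nsNG ntN (g^-1%g None).
  apply/mulsgP; exists (n^-1)%g (n * g)%g; rewrite ?groupV ?mulKg //.
  have Gn := subsetP sNG n Nn.
  by rewrite in_stab groupM //= permM np permKV.
have der2 : (G^`(2) = G)%g by rewrite dergSn moebius_perfect -derg1 moebius_perfect.
apply/eqP; rewrite eqEsubset sNG -quotient_sub1 // -{1}der2 quotient_der //.
rewrite -{1}defG quotientMidl -quotient_der ?borel_metabelian ?quotient1 ?sub1G //.
by rewrite subIset // nNG.
Qed.

Lemma moebius_nonabelian : ~~ abelian G.
Proof.
apply/negP=> /derG1P; rewrite moebius_perfect => G1.
have := moebius_simple; rewrite G1 => /simpleP[]; by rewrite eqxx.
Qed.


(** A map [a x + b] with [a != 1] fixes infinity and [b / (1 - a)]; a translation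
    by [b] swaps [0] and [b] in characteristic two. *)
Lemma borel_fixes_pair (g : {perm P}) : g \in borel ->
  exists p q : P, p != q /\ g @: [set p; q] = [set p; q].
Proof.
case/borelP=> a [b [a0 ->]]; have [a1 | a1] := eqVneq a 1.
  have [b0 | b0] := eqVneq b 0.
    exists None, (Some 0); split=> //.
    by rewrite imsetU1 imset_set1 affine_inf // affineE // a1 b0 mul1r addr0.
  exists (Some 0), (Some b); split; first by apply: contraNneq b0 => -[<-].
  rewrite imsetU1 imset_set1 !affineE // a1 !mul1r add0r addrr_pchar2 //.
  by rewrite setUC.
exists None, (Some (b / (1 - a))); split=> //.
have a10 : 1 - a != 0 by rewrite subr_eq0 eq_sym.
rewrite imsetU1 imset_set1 affine_inf // affineE //; congr [set _; Some _].
by field.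
Qed.

(** The map [z ^ 2 + z] takes the same value at [0] and [1], so on a finite field
    it misses some value [n]: the polynomial [X ^ 2 + X - n] is irreducible. *)
Lemma irreducible_constant : exists n : F, forall z, z ^+ 2 + z != n.
Proof.
pose h (z : F) := z ^+ 2 + z.
have ninj : ~ injective h.
  move=> /(_ 0 1); rewrite /h expr0n expr1n addr0 addrr_pchar2 // => /(_ erefl)/eqP.
  by rewrite eq_sym oner_eq0.
have /existsP[n /forallP nn] : [exists n, [forall z, h z != n]]; last by exists n.
apply: contraT; rewrite negb_exists => /forallP onto_h; case: ninj.
have onto : #|codom h| = #|F|.
  apply: eq_card => n; rewrite inE.
  have := onto_h n; rewrite negb_forall => /existsP[z]; rewrite negbK => /eqP <-.
  exact: codom_f.
have /image_injP inj : #|codom h| == #|F| by apply/eqP.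
by move=> x y exy; apply: inj.
Qed.

(** The torus and the flip generate the stabilizer of the pair of [None] and
    [Some 0], so this is the maximality of that stabilizer. A larger group [M]
    is transitive on the line, as the torus is transitive on the other points.
    Either [M] has an element fixing infinity and moving [0]; composing it with
    the torus gives all translations, so [M] contains the Borel subgroup. Or
    every element fixing infinity also fixes [0]; then, for [g] in [M] moving
    infinity to [1], the element [g * flip * g^-1] fixes infinity, so the flip
    fixes [g 0] besides [1]. This is impossible, since in characteristic two
    [1] is the only solution of [x ^ 2 = 1]. *)
Lemma torus_flip_maximal (M : {group {perm P}}) (m : {perm P}) (p : P) :
  M \subset G -> (forall a, a != 0 -> affine a 0 \in M) -> flip \in M -> m \in M ->
  p \in pred2 None (Some 0) -> m p \notin pred2 None (Some 0) -> M :=: G.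
Proof.
move=> sMG torM flipM Mm pD mpD.
have [n Mn [c c0 nc]] : exists2 n, n \in M & exists2 c, c != 0 & n None = Some c.
  have out (q : P) : q \notin pred2 None (Some 0) -> exists2 c, c != 0 & q = Some c.
    by case: q => [c|] // nq; exists c => //; apply: contraNneq nq => ->; rewrite !inE eqxx orbT.
  have [c c0 def_c] := out _ mpD.
  case/pred2P: pD => def_p; rewrite def_p in def_c; first by exists m => //; exists c.
  by exists (flip * m)%g; rewrite ?groupM //; exists c; rewrite // permM flip_inf.
have trM q : exists2 n, n \in M & n None = q.
  case: q => [x|]; last by exists 1%g; rewrite ?group1 ?perm1.
  have [-> | x0] := eqVneq x 0; first by exists flip; rewrite ?flip_inf.
  have xc0 : x / c != 0 by rewrite mulf_neq0 ?invr_eq0.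
  exists (n * affine (x / c) 0)%g; first by rewrite groupM ?torM.
  by rewrite permM nc affineE // addr0 divfK.
apply: sub_borel_transitive => //.
have [/existsP[g /and3P[Mg /eqP g_inf g0]] | none] :=
  boolP [exists g, [&& g \in M, g None == None & g (Some 0) != Some 0]].
  have [a [b [a0 def_g]]] := stab_inf_affine (subsetP sMG g Mg) g_inf.
  have b0 : b != 0.
    by apply: contraNneq g0 => b0; rewrite def_g affineE // b0 mulr0 addr0.
  have trans1 : affine 1 b \in M.
    have -> : affine 1 b = (affine a^-1 0 * affine a b)%g.
      by rewrite affine_comp ?invr_eq0 // mulr0 add0r mulfV.
    by rewrite groupM ?torM ?invr_eq0 // -def_g.
  apply/subsetP=> _ /borelP[a' [e [a'0 ->]]]; rewrite affine_split // groupM ?torM //.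
  have [-> | e0] := eqVneq e 0; first by rewrite torM ?oner_neq0.
  have be0 : b / e != 0 by rewrite mulf_neq0 ?invr_eq0.
  have eb0 : e / b != 0 by rewrite mulf_neq0 ?invr_eq0.
  have -> : affine 1 e = (affine (b / e) 0 * affine 1 b * affine (e / b) 0)%g.
    rewrite !affine_comp ?mulf_neq0 ?oner_neq0 ?invr_eq0 //.
    by congr affine; field; rewrite ?b0 ?e0.
  by rewrite !groupM ?torM.
have [g Mg g1] := trM (Some 1).
have fix0 h : h \in M -> h None = None -> h (Some 0) = Some 0.
  move=> Mh hinf; apply: contraNeq none => h0; apply/existsP; exists h.
  by rewrite Mh hinf eqxx.
have flip1 : flip (Some 1) = Some 1 by rewrite flipE ?oner_neq0 // invr1.
have : flip (g (Some 0)) = g (Some 0).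
  have := fix0 (g * flip * g^-1)%g; rewrite !groupM ?groupV // !permM g1 flip1 -g1 permK.
  by move=> /(_ isT erefl) /(congr1 g); rewrite permKV.
have : g (Some 0) != Some 1 by rewrite -g1 (inj_eq perm_inj).
case: (g _) => [x|]; last by rewrite flip_inf.
have [-> | x0] := eqVneq x 0; first by rewrite flip0.
move=> x1; rewrite flipE // => -[xV]; case/negP: x1; apply/eqP; congr Some.
have : (x - 1) ^+ 2 == 0.
  have := pFrobenius_autB_comm char2 (mulrC x 1); rewrite !pFrobenius_autE => ->.
  by rewrite expr1n expr2 -{1}xV mulVf // subrr.
by rewrite expf_eq0 subr_eq0 => /eqP.
Qed.


(** The group [R] is the image of the multiplicative group of the field obtained
    by adjoining a root [theta] of [X ^ 2 + X - n], acting by multiplication on the line over [F]: the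
    matrix of [x + y theta] is [sm x y]. Its elements with a fixed point are the
    scalars. It is transitive because [None] is moved to [x : y]. If [r] preserves
    an unordered pair, then [r ^ 2] fixes a point, so [r ^ 2 = 1]; and [R] has
    odd order [q + 1]. *)
Lemma singer_cycle : exists R : {group {perm P}},
  [/\ R \subset G, regular_perm R
    & forall r (p q : P), r \in R -> r @: [set p; q] = [set p; q] -> r = 1%g].
Proof.
have [n irr_n] := irreducible_constant.
pose sm (x y : F) : matrix2 := (x, n * y, y, x + y).
have sdet x y : (x != 0) || (y != 0) -> det2 (sm x y) != 0.
  rewrite /det2 /sm; have [-> | y0 _] := eqVneq y 0.
    by rewrite orbF => x0; rewrite addr0 !mulr0 subr0 mulf_neq0.
  have -> : x * (x + y) - n * y * y = y ^+ 2 * ((x / y) ^+ 2 + x / y - n).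
    by field.
  by rewrite mulf_neq0 ?expf_neq0 // subr_eq0.
pose R0 : {set {perm P}} :=
  [set mperm (sm v.1 v.2) | v : F * F & (v.1 != 0) || (v.2 != 0)].
have R0P r : reflect (exists x y : F, (x != 0) || (y != 0) /\ r = mperm (sm x y)) (r \in R0).
  apply: (iffP imsetP) => [[[x y]] | [x [y [v0 ->]]]].
    by rewrite inE /= => v0 ->; exists x, y.
  by exists (x, y); rewrite ?inE.
have gR0 : group_set R0.
  apply/group_setP; split.
    have d : det2 (sm 1 0) != 0 by apply: sdet; rewrite oner_eq0.
    apply/R0P; exists 1, 0; rewrite oner_eq0; split=> //.
    by apply/permP=> z; rewrite perm1 mpermE // /sm mulr0 addr0 mob_scalar ?oner_neq0.
  move=> _ _ /R0P[x [y [v0 ->]]] /R0P[x' [y' [v0' ->]]].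
  pose a := x * x' + n * y * y'; pose b := x * y' + x' * y + y * y'.
  have detw : det2 (sm a b) = det2 (sm x y) * det2 (sm x' y').
    by rewrite /sm /a /b /det2; ring.
  have dw : det2 (sm a b) != 0 by rewrite detw mulf_neq0 ?sdet.
  have nzw : (a != 0) || (b != 0).
    apply: contraNT dw; rewrite negb_or !negbK => /andP[/eqP-> /eqP->].
    by rewrite /det2 /sm !mulr0 subr0 mul0r.
  apply/R0P; exists a, b; split=> //.
  apply/permP=> z; rewrite permM !mpermE ?sdet //.
  rewrite /sm mob_comp ?(sdet x y) //.
  by rewrite /a /b; congr mob; congr (_, _, _, _); ring.
pose R := Group gR0.
have sRG : R \subset G.
  by apply/subsetP=> _ /R0P[x [y [v0 ->]]]; rewrite mperm_in ?sdet.
have srR : semiregular_perm R.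
  move=> _ /R0P[x [y [v0 ->]]] p; rewrite mpermE ?sdet //.
  have scal : y = 0 -> mperm (sm x y) = 1%g.
    move=> y0; have x0 : x != 0 by move: v0; rewrite y0 eqxx orbF.
    apply/permP=> z; rewrite mpermE ?sdet // perm1 /sm y0 mulr0 addr0.
    exact: mob_scalar.
  case: p => [z|] /=; rewrite /homog; last first.
    by have [/scal | ] := eqVneq y 0.
  case: ifP => // /negbT d0 [] /(canRL (divfK d0)) ez; apply: scal; apply/eqP.
  (* A fixed point z of sm x y is a root of y * (X ^ 2 + X - n). *)
  have : y * (z ^+ 2 + z - n) == 0.
    have -> : y * (z ^+ 2 + z - n) = z * (y * z + (x + y)) - (x * z + n * y) by ring.
    by rewrite subr_eq0 -ez.
  by rewrite mulf_eq0 subr_eq0 (negPf (irr_n z)) orbF.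
have trR : [transitive R, on [set: P] | 'P].
  apply/imsetP; exists None; rewrite ?inE //; apply/esym/setP=> p; rewrite inE.
  apply/imsetP; case: p => [z|]; last by exists 1%g; rewrite ?group1 //= /aperm perm1.
  have v0 : (z != 0) || (1 != 0 :> F) by rewrite oner_neq0 orbT.
  exists (mperm (sm z 1)); first by apply/R0P; exists z, 1.
  by rewrite /= /aperm mpermE ?sdet //= /homog oner_eq0 divr1.
have regR : regular_perm R by [].
exists R; split=> // r p q Rr fix_pq.
have oddR : odd #|R|.
  rewrite (regular_card None regR) card_option /=.
  by rewrite cardF oddX.
have rp : r p \in [set p; q] by rewrite -fix_pq imset_f ?set21.
have rq : r q \in [set p; q] by rewrite -fix_pq imset_f ?set22.
case/set2P: rp => rp; first exact: srR rp.
case/set2P: rq => rq; last exact: srR rq.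
have rr : (r ^+ 2 = 1)%g.
  by apply: (srR _ _ p); rewrite ?groupX // expgS expg1 permM rp rq.
have dvd2 : (#[r] %| 2)%N by rewrite order_dvdn rr.
apply/eqP; rewrite -order_eq1 -dvdn1.
have -> : 1%N = gcdn 2 #|R| by apply/esym/eqP; rewrite -/(coprime 2 _) coprime2n.
by rewrite dvdn_gcd dvd2 order_dvdG.
Qed.

End Moebius.

(** * The action on unordered pairs of points *)

(** What is needed of a simple primitive group to analyse its wreath products in
    product action. The factor [S] is a subgroup, so it is
    intersecting as soon as each of its elements fixes a point. *)
Record ekr_factorized (Delta : finType) (T R S : {group {perm Delta}}) : Prop :=
  EkrFactorized {
    ef_prim : [primitive T, on [set: Delta] | 'P];
    ef_simple : simple T;
    ef_nonabelian : ~~ abelian T;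
    ef_stab : forall w, 'C_T[w | 'P] :!=: 1;
    ef_subR : R \subset T;
    ef_semiregular : semiregular_perm R;
    ef_subS : S \subset T;
    ef_fix : forall s, s \in S -> exists w : Delta, s w = w;
    ef_fact : T = R * S :> {set _}
  }.

Section PairAction.

Variable P : finType.

Definition pairs := {A : {set P} | #|A| == 2}.

Definition mk_pair (A : {set P}) (cA : #|A| == 2) : pairs := exist _ A cA.

Lemma pair_img_subproof (g : {perm P}) (A : pairs) : #|g @: val A| == 2.
Proof. by rewrite card_imset ?(valP A) //; exact: perm_inj. Qed.

Definition pair_img (g : {perm P}) (A : pairs) : pairs :=
  mk_pair (pair_img_subproof g A).

Lemma pair_img_inj g : injective (pair_img g).
Proof.
move=> A B /(congr1 val) /= eqAB; apply: val_inj.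
by apply: imset_inj eqAB; apply: perm_inj.
Qed.

Definition pair_perm (g : {perm P}) : {perm pairs} := perm (@pair_img_inj g).

Lemma pair_permE g A : val (pair_perm g A) = g @: val A.
Proof. by rewrite permE. Qed.

Lemma pair_permM : {in [set: {perm P}] &, {morph pair_perm : g h / g * h}}.
Proof.
move=> g h _ _; apply/permP=> A; rewrite permM; apply: val_inj.
by rewrite !pair_permE -imset_comp; apply: eq_imset => x /=; rewrite permM.
Qed.
Canonical pair_morphism := Morphism pair_permM.

(** If [g] moves [p], a third point [x] gives a pair [p, x] that is not preserved:
    [g p] would have to be [x]. *)
Lemma injm_pair : (2 < #|P|)%N -> 'injm pair_morphism.
Proof.
move=> cardP; apply/subsetP=> g /mker g1; apply/set1P/permP=> p; rewrite perm1.
apply/eqP; apply/idPn=> neq_gp.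
have /subsetPn[x _] : ~~ ([set: P] \subset [set p; g p]).
  apply: contraTN cardP => /subset_leq_card.
  by rewrite cardsT cards2 (eq_sym p) neq_gp -leqNgt.
rewrite !inE negb_or => /andP[xp xgp].
have cA : #|[set p; x]| == 2 by rewrite cards2 (eq_sym p) xp.
have := congr1 (fun h : {perm pairs} => val (h ((mk_pair cA)))) g1.
rewrite pair_permE perm1 /= imsetU1 imset_set1 => /setP/(_ (g p)).
by rewrite !inE eqxx (negPf neq_gp) (eq_sym _ x) (negPf xgp).
Qed.

Lemma pairP (A : pairs) : exists p q, p != q /\ val A = [set p; q].
Proof. by have /cards2P[p [q [neq_pq defA]]] := valP A; exists p, q. Qed.

End PairAction.

Section MoebiusPairs.

Variables (F : finFieldType) (f : nat).
Hypothesis cardF : #|F| = (2 ^ f.+2)%N.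

Local Notation G := (moebius_group F).
Local Notation P := (option F).
Local Notation psi := (@pair_morphism P).

Let injpsi : 'injm psi.
Proof.
apply: injm_pair; rewrite card_option cardF ltnS.
by rewrite (@ltn_exp2l 2 0).
Qed.

Let psi_in (g : {perm P}) (H : {group {perm P}}) : g \in H -> psi g \in psi @* H.
Proof. by move=> Hg; rewrite mem_morphim ?inE. Qed.

Let pair0_proof : #|[set None; Some 0%R : P]| == 2.
Proof. by rewrite cards2. Qed.
Let w0 : pairs P := mk_pair pair0_proof.

Lemma pairs_transitive : [transitive psi @* G, on [set: pairs P] | 'P].
Proof.
apply/imsetP; exists w0; rewrite ?inE //; apply/esym/setP=> A; rewrite inE.
have [p [q [neq_pq defA]]] := pairP A.
have [g Gg [gp gq]] := moebius_two_transitive_inf0 neq_pq.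
apply/imsetP; exists (psi g); first exact: psi_in.
apply: val_inj; rewrite /= /aperm pair_permE /= imsetU1 imset_set1 gp gq.
exact: defA.
Qed.

Lemma pairs_primitive : [primitive psi @* G, on [set: pairs P] | 'P].
Proof.
rewrite (trans_prim_astab (in_setT w0) pairs_transitive).
apply/maximal_eqP; split=> [|H sCH sHG]; first exact: subsetIl.
pose M := (psi @*^-1 H :&: G)%G.
have inM g : g \in G -> psi g \in H -> g \in M.
  by move=> Gg Hg; rewrite inE Gg andbT mem_morphpre ?inE.
have stab_in g : g \in G -> g @: val w0 = val w0 -> g \in M.
  move=> Gg fixg; apply: inM => //; apply: (subsetP sCH).
  rewrite in_stab psi_in //=; apply/eqP/val_inj; by rewrite pair_permE.
have [/existsP[m /andP[Mm /existsP[p /andP[pw mpw]]]] | none] :=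
  boolP [exists m, (m \in M) && [exists p, (p \in val w0) && (m p \notin val w0)]].
  right; have eqMG : M :=: G.
    apply: (@torus_flip_maximal F f cardF _ m p) => //; first exact: subsetIr.
    - move=> a a0; apply: stab_in; first exact: affine_in.
      by rewrite /= imsetU1 imset_set1 affine_inf // affineE // mulr0 addr0.
    - apply: stab_in; first exact: flip_in.
      by rewrite /= imsetU1 imset_set1 flip_inf flip0 setUC.
    - by move: pw; rewrite /= !inE.
    by move: mpw; rewrite /= !inE.
  apply/eqP; rewrite eqEsubset sHG /= -eqMG; apply/subsetP=> _ /morphimP[g _ Mg ->].
  by move: Mg; rewrite !inE => /andP[/andP[]].
left; apply/eqP; rewrite eqEsubset sCH andbT; apply/subsetP=> h Hh.
have /morphimP[g _ Gg def_h] := subsetP sHG h Hh.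
have Mg : g \in M by apply: inM; rewrite -?def_h.
rewrite in_stab (subsetP sHG) //= def_h; apply/eqP/val_inj; rewrite pair_permE.
apply/eqP; rewrite eqEcard card_imset; last exact: perm_inj.
rewrite leqnn andbT; apply/subsetP=> _ /imsetP[p pw ->].
apply: contraR none => gpw; apply/existsP; exists g; rewrite Mg.
by apply/existsP; exists p; rewrite pw.
Qed.

(** On the line, the Singer cycle is transitive and the Borel subgroup is a point
    stabilizer, which gives the factorization. *)
Lemma moebius_pairs_factorized : exists R S : {group {perm (pairs P)}},
  ekr_factorized (psi @* G)%G R S /\ #|R| = #|F|.+1.
Proof.
have [R [sRG regR pairR]] := singer_cycle cardF.
have [srR trR] := regR.
exists (psi @* R)%G, (psi @* borel F)%G; split; last first.
  by rewrite /= card_injm ?subsetT // (regular_card None regR) card_option.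
have fixS s : s \in psi @* borel F -> exists w : pairs P, s w = w.
  case/morphimP=> g _ Bg ->.
  have [p [q [neq_pq fixpq]]] := borel_fixes_pair cardF Bg.
  have cA : #|[set p; q]| == 2 by rewrite cards2 neq_pq.
  by exists ((mk_pair cA)); apply: val_inj; rewrite pair_permE.
split=> //.
- exact: pairs_primitive.
- by rewrite /= -(isog_simple (sub_isog (subsetT G) injpsi)) (moebius_simple cardF).
- by rewrite /= injm_abelian ?subsetT // (moebius_nonabelian cardF).
- move=> w.
  have affB : affine 1%R 1%R \in borel F.
    by apply/borelP; exists 1%R, 1%R; rewrite oner_neq0.
  have [v fix_v] := fixS _ (psi_in affB).
  have [g Gg def_w] := atransP2 pairs_transitive (in_setT v) (in_setT w).
  apply/trivgPn; exists (psi (affine 1%R 1%R) ^ g).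
    rewrite in_stab groupJ //=; last exact/psi_in/affine_in/oner_neq0.
    by rewrite def_w conjgE !permM permK fix_v.
  rewrite conjg_eq1; apply/eqP=> a1.
  have : affine 1%R 1%R \in 'ker psi by apply/kerP; rewrite ?inE.
  move/(subsetP injpsi)/set1P/permP/(_ (Some 0%R)).
  rewrite affineE ?oner_neq0 // perm1 mulr0 add0r => -[].
  by apply/eqP; rewrite oner_neq0.
- exact: morphimS.
- move=> _ /morphimP[r _ Rr ->] A fixA.
  have [p [q [_ defA]]] := pairP A.
  rewrite (pairR r p q Rr) ?morph1 // -defA -pair_permE.
  by congr val.
- by apply: morphimS; apply: subsetIl.
rewrite /= -morphimMl ?subsetT //; congr (_ @* _).
apply/eqP; rewrite eqEsubset mul_subG ?subsetIl // andbT; apply/subsetP=> g Gg.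
have [r Rr rp] := atransP2 trR (in_setT (None : P)) (in_setT (g^-1 None)).
apply/mulsgP; exists r^-1 (r * g); rewrite ?groupV ?mulKg //.
rewrite in_stab groupM ?(subsetP sRG r) //= permM.
by move: rp; rewrite /= /aperm => <-; rewrite permKV.
Qed.

End MoebiusPairs.

(** * Wreath products in product action *)

Section Wreath.

Variables (Delta : finType) (l : nat).
Local Notation X := {ffun 'I_l -> Delta}.
Implicit Types (h : {ffun 'I_l -> {perm Delta}}) (s : 'S_l) (A : {group {perm Delta}}).

(** Coordinates are permuted before [h] acts, and [s] acts by pulling back; hence
    the products of the [s] components appear in reverse order in [wrM]. *)
Definition wr_fun h s (x : X) : X := [ffun i => h i (x (s i))].

Lemma wr_fun_inj h s : injective (wr_fun h s).
Proof.
move=> x y /ffunP eqxy; apply/ffunP=> i; have := eqxy (s^-1 i).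
by rewrite !ffunE permKV => /perm_inj.
Qed.

Definition wr h s : {perm X} := perm (@wr_fun_inj h s).

Lemma wrE h s x i : wr h s x i = h i (x (s i)).
Proof. by rewrite permE ffunE. Qed.

Lemma wrM h s h' s' :
  wr h s * wr h' s' = wr [ffun i => h (s' i) * h' i] (s' * s).
Proof.
by apply/permP=> x; apply/ffunP=> i; rewrite permM !wrE ffunE !permM.
Qed.

Lemma wr1 : wr [ffun=> 1] 1 = 1.
Proof. by apply/permP=> x; apply/ffunP=> i; rewrite wrE ffunE !perm1. Qed.

Definition wreath_set A : {set {perm X}} :=
  [set wr h s | h in ffun_on (mem A), s in [set: 'S_l]].

Lemma wreathP A g :
  reflect (exists h s, (forall i, h i \in A) /\ g = wr h s) (g \in wreath_set A).
Proof.
apply: (iffP imset2P) => [[h s /ffun_onP Ah _ ->] | [h [s [Ah ->]]]].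
  by exists h, s.
by exists h s; rewrite ?inE //; apply/ffun_onP.
Qed.

Lemma wreath_group_set A : group_set (wreath_set A).
Proof.
apply/group_setP; split.
  by apply/wreathP; exists [ffun=> 1], 1; rewrite wr1; split=> // i; rewrite ffunE.
move=> _ _ /wreathP[h [s [Ah ->]]] /wreathP[h' [s' [Ah' ->]]]; rewrite wrM.
by apply/wreathP; do 2!eexists; split; last by []; move=> i; rewrite ffunE groupM.
Qed.
Canonical wreath A := Group (wreath_group_set A).

Definition base_set A : {set {perm X}} := [set wr h 1 | h in ffun_on (mem A)].

Lemma baseP A g :
  reflect (exists h, (forall i, h i \in A) /\ g = wr h 1) (g \in base_set A).
Proof.
apply: (iffP imsetP) => [[h /ffun_onP Ah ->] | [h [Ah ->]]].
  by exists h.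
by exists h => //; apply/ffun_onP.
Qed.

Lemma base_group_set A : group_set (base_set A).
Proof.
apply/group_setP; split.
  by apply/baseP; exists [ffun=> 1]; rewrite wr1; split=> // i; rewrite ffunE.
move=> _ _ /baseP[h [Ah ->]] /baseP[h' [Ah' ->]]; rewrite wrM mulg1.
by apply/baseP; eexists; split; last by []; move=> i; rewrite ffunE perm1 groupM.
Qed.
Canonical base A := Group (base_group_set A).

Lemma card_base A (d : Delta) : #|base A| = (#|A| ^ l)%N.
Proof.
rewrite card_imset ?card_ffun_on ?card_ord // => h h' eqw.
apply/ffunP=> i; apply/permP=> z.
have := congr1 (fun g : {perm X} => g [ffun=> z] i) eqw.
by rewrite !wrE !ffunE.
Qed.

Lemma wreath_sub_product_action A : wreath A \subset @product_action_wreath Delta l.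
Proof.
apply/subsetP=> _ /wreathP[h [s [_ ->]]].
have -> : wr h s = wr [ffun=> 1] s * wr h 1.
  by rewrite wrM mul1g; congr wr; apply/ffunP=> i; rewrite !ffunE mul1g.
apply: groupM; apply: mem_gen; rewrite inE.
  apply/orP; right; rewrite inE; apply/existsP; exists s; apply/forallP=> x.
  by apply/eqP/ffunP=> i; rewrite wrE !ffunE perm1.
apply/orP; left; rewrite inE; apply/existsP; exists h; apply/forallP=> x.
by apply/eqP/ffunP=> i; rewrite wrE !ffunE perm1.
Qed.

Definition coord_perm (j : 'I_l) (t : {perm Delta}) : {perm X} :=
  wr [ffun i => if i == j then t else 1] 1.

Lemma coord_permE j t x i :
  coord_perm j t x i = if i == j then t (x i) else x i.
Proof. by rewrite wrE ffunE perm1; case: eqP => // _; rewrite perm1. Qed.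

Lemma coord_permM j : {in [set: {perm Delta}] &, {morph coord_perm j : t u / t * u}}.
Proof.
move=> t u _ _; apply/permP=> x; apply/ffunP=> i.
by rewrite permM !coord_permE; case: eqP => // _; rewrite permM.
Qed.
Canonical coord_morphism j := Morphism (@coord_permM j).

Lemma injm_coord j : 'injm (coord_morphism j).
Proof.
apply/subsetP=> t /mker t1; apply/set1P/permP=> z.
have := congr1 (fun g : {perm X} => g [ffun=> z] j) t1.
by rewrite /= coord_permE eqxx !perm1 ffunE.
Qed.

Lemma coord_permJ h s i t :
  coord_perm (s i) t ^ wr h s = coord_perm i (t ^ h i).
Proof.
rewrite conjgE; apply: (mulgI (wr h s)); rewrite mulKVg.
apply/permP=> x; apply/ffunP=> k; rewrite !permM wrE !coord_permE !wrE.
rewrite (inj_eq perm_inj); case: eqP => // ->.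
by rewrite conjgE !permM permK.
Qed.

(** An element of the base group is the product of its coordinates, listed in any
    order. *)
Lemma base_mem_coord (H : {group {perm X}}) h :
  (forall i, coord_perm i (h i) \in H) -> wr h 1 \in H.
Proof.
move=> Hh; pose hr (r : seq 'I_l) : {ffun 'I_l -> {perm Delta}} :=
  [ffun i => if i \in r then h i else 1].
suff Hr r : uniq r -> wr (hr r) 1 \in H.
  have -> : h = hr (enum 'I_l) by apply/ffunP=> i; rewrite ffunE mem_enum.
  exact/Hr/enum_uniq.
elim: r => [_ | j r IHr /= /andP[r'j /IHr Hwr]].
  have -> : hr [::] = [ffun=> 1] by apply/ffunP=> i; rewrite !ffunE.
  by rewrite wr1.
have -> : wr (hr (j :: r)) 1 = coord_perm j (h j) * wr (hr r) 1; last exact: groupM.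
rewrite wrM mulg1; congr wr; apply/ffunP=> i; rewrite !ffunE perm1 inE.
by case: eqP => [-> | _]; rewrite ?(negPf r'j) ?mulg1 ?mul1g.
Qed.

(** A fixed point [x] must satisfy [x (s i) = (h i)^-1 (x i)], so on the cycle of
    [s] through [r] it is determined by [x r]: the value at the [k]-th iterate of
    [r] is obtained by applying [w r k]. The only constraint is that the product
    [w r] over the whole cycle fixes [x r], and this product lies in [A]. *)
Lemma wreath_fixed_point A g :
  (forall a, a \in A -> exists d : Delta, a d = d) -> g \in wreath A ->
  exists x : X, g x = x.
Proof.
move=> fixA /wreathP[h [s [Ah ->]]].
pose fix w (r : 'I_l) (k : nat) : {perm Delta} :=
  if k is k'.+1 then w r k' * (h (iter k' s r))^-1 else 1.
have Aw r k : w r k \in A by elim: k => //= k IHk; rewrite groupM ?groupV.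
have [p fixp] := fin_all_exists (fun r : 'I_l => fixA _ (Aw r (fingraph.order s r))).
have injs : injective s := @perm_inj _ s.
pose x : X := [ffun i => w (froot s i) (findex s (froot s i) i) (p (froot s i))].
exists x; apply/ffunP=> i; rewrite wrE.
have root_si : froot s (s i) = froot s i.
  by apply/esym/eqP; rewrite (root_connect (fconnect_sym injs)) fconnect1.
rewrite !ffunE root_si; set r := froot s i; set k := findex s r i.
have conn : fconnect s r i by rewrite (fconnect_sym injs) connect_root.
have def_i : iter k s r = i := iter_findex conn.
have lt_k : k < fingraph.order s r := findex_max conn.
have -> : w r (findex s r (s i)) (p r) = w r k.+1 (p r).
  (* At the end of the cycle the index drops to 0, where p r is fixed by w r. *)
  have [lt_k1 | ge_k1] := ltnP k.+1 (fingraph.order s r).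
    by rewrite -{1}def_i -iterS findex_iter.
  have ek : k.+1 = fingraph.order s r by apply/eqP; rewrite eqn_leq lt_k.
  have -> : s i = r by rewrite -{1}def_i -iterS ek iter_order.
  by rewrite findex0 ek fixp /= perm1.
by rewrite /= permM def_i permKV.
Qed.

End Wreath.
Arguments coord_morphism {Delta l} j.
Arguments injm_coord {Delta l} j.

Section ProductPrimitive.

Variables (Delta : finType) (T : {group {perm Delta}}).
Hypothesis primT : [primitive T, on [set: Delta] | 'P].
Hypothesis simT : simple T.
Hypothesis nabT : ~~ abelian T.
Hypothesis stabT : forall w, 'C_T[w | 'P] :!=: 1.

Let trT : [transitive T, on [set: Delta] | 'P].
Proof. by case/andP: primT. Qed.

Let maxT d (H : {group {perm Delta}}) :
  'C_T[d | 'P] \subset H -> H \subset T -> H :=: 'C_T[d | 'P] \/ H :=: T.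
Proof.
have := primT; rewrite (trans_prim_astab (in_setT d) trT) => /maximal_eqP[_].
by apply.
Qed.

Lemma stab_moves d : exists2 t, t \in T & t d != d.
Proof.
have [/existsP[t /andP[Tt td]] | none] := boolP [exists t, (t \in T) && (t d != d)].
  by exists t.
have fixd t : t \in T -> t d = d.
  by move=> Tt; apply: contraNeq none => td; apply/existsP; exists t; rewrite Tt.
have [ntT _] := simpleP _ simT; case/negP: ntT; rewrite -subG1.
apply/subsetP=> t Tt; apply/set1P/permP=> z; rewrite perm1.
have [g Tg ->] := atransP2 trT (in_setT d) (in_setT z).
by rewrite /= /aperm -permM !fixd ?groupM.
Qed.

(** The point stabilizer is its own normalizer: by maximality the normalizer is
    the stabilizer or [T], and the stabilizer is not normal in the simple group
    [T], being neither trivial nor [T]. *)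
Lemma norm_stab_fix d g : g \in T -> 'C_T[d | 'P] :^ g \subset 'C_T[d | 'P] -> g d = d.
Proof.
move=> Tg nCg; set C := 'C_T[d | 'P] in nCg *.
have sCT : C \subset T := subsetIl _ _.
have Ng : g \in 'N_T(C) by rewrite inE Tg inE.
have [||eqN | eqN] := @maxT d 'N_T(C)%G.
- by rewrite subsetI sCT normG.
- exact: subsetIl.
- by have : g \in C; [rewrite -[C]eqN | rewrite in_stab => /andP[_ /eqP]].
have sTN : T \subset 'N(C) by rewrite -eqN subsetIr.
have nsCT : C <| T by rewrite /normal sCT.
have [_ simT'] := simpleP _ simT.
have [C1 | CT] := simT' _ nsCT; first by case/eqP: (stabT d).
have [t Tt td] := stab_moves d.
by move: Tt; rewrite -[T : {set _}]CT /= in_stab (negPf td) andbF.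
Qed.

(** An element of [T] moving [d] to [d'] conjugates one stabilizer to the other,
    so under inclusion it normalizes the stabilizer of [d]. *)
Lemma stab_sub_eq d d' : 'C_T[d | 'P] \subset 'C_T[d' | 'P] -> d = d'.
Proof.
have [g Tg ->] := atransP2 trT (in_setT d) (in_setT d') => sCC.
have eqC : 'C_T[aperm d g | 'P] = 'C_T[d | 'P] :^ g.
  by rewrite conjIg conjGid // (astab1_act 'P).
apply/esym/norm_stab_fix => //.
apply/subsetP=> y; rewrite -eqC => Cy.
have /eqP eq : 'C_T[d | 'P] == 'C_T[aperm d g | 'P].
  by rewrite eqEcard sCC eqC cardJg leqnn.
by rewrite eq.
Qed.

Lemma simple_center t : t \in T -> (forall u, u \in T -> commute t u) -> t = 1.
Proof.
move=> Tt ct; have [_ simT'] := simpleP _ simT.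
have [Z1 | ZT] := simT' _ (center_normal T).
  by apply/set1P; rewrite -[[set 1]]Z1; apply/centerP.
by case/negP: nabT; apply/center_idP.
Qed.

Variable l : nat.
Local Notation X := {ffun 'I_l -> Delta}.
Local Notation G := (wreath l T).
Local Notation E := (fun j : 'I_l => (coord_morphism j @* T)%G).
Local Notation e := (@coord_morphism Delta l).
Local Notation N := (\prod_(j < l) E j)%G.

Lemma coordP j g : reflect (exists2 t, t \in T & g = coord_perm j t) (g \in E j).
Proof.
apply: (iffP idP) => [/morphimP[t _ Tt ->] | [t Tt ->]]; first by exists t.
by apply: (mem_morphim (e j)); rewrite ?inE.
Qed.

Lemma coord_in j t : t \in T -> coord_perm j t \in E j.
Proof. by move=> Tt; apply/coordP; exists t. Qed.

Lemma coord_wreath (A : {group {perm Delta}}) j t : t \in A -> coord_perm j t \in wreath l A.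
Proof.
move=> At; apply/wreathP; do 2!eexists; split; last by [].
by move=> i; rewrite ffunE; case: ifP.
Qed.

Lemma top_wreath (A : {group {perm Delta}}) s : wr [ffun=> 1] s \in wreath l A.
Proof. by apply/wreathP; do 2!eexists; split; last by []; move=> i; rewrite ffunE. Qed.

Lemma coord_N j : E j \subset N.
Proof. by rewrite bigprodGE sub_gen // (bigcup_max j). Qed.

Lemma sub_N (H : {group {perm X}}) : (forall j, E j \subset H) -> N \subset H.
Proof. by move=> sEH; rewrite bigprodGE gen_subG; apply/bigcupsP=> j _. Qed.

Lemma base_sub_N (h : {ffun 'I_l -> {perm Delta}}) : (forall i, h i \in T) -> wr h 1 \in N.
Proof.
by move=> Th; apply: base_mem_coord => i; apply: (subsetP (coord_N i)); apply: coord_in.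
Qed.

Lemma N_base : N \subset base l T.
Proof.
apply: sub_N => j; apply/subsetP=> _ /coordP[t Tt ->].
by apply/baseP; eexists; split; last by []; move=> i; rewrite ffunE; case: ifP.
Qed.

Lemma N_wreath : N \subset G.
Proof.
by apply: sub_N => j; apply/subsetP=> _ /coordP[t Tt ->]; apply: coord_wreath.
Qed.

Lemma N_normal : N <| G.
Proof.
rewrite /normal N_wreath bigprodGE; apply/norms_gen/subsetP=> g Gg.
rewrite inE; apply/subsetP=> _ /imsetP[_ /bigcupP[j _ /coordP[t Tt ->]] ->].
have [h [s [Th ->]]] := wreathP _ _ Gg.
rewrite -[j](permKV s) coord_permJ.
by apply/bigcupP; exists (s^-1 j) => //; apply/coord_in/groupJ.
Qed.

Lemma N_transitive : [transitive N, on [set: X] | 'P].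
Proof.
have [d _ _] := imsetP trT; pose x : X := [ffun=> d].
apply/imsetP; exists x; rewrite ?inE //; apply/esym/setP=> y; rewrite inE.
have [t /all_and2 [Tt tx]] := fin_all_exists (fun i =>
   let: ex_intro2 t Tt tx := atransP2 trT (in_setT (x i)) (in_setT (y i)) in
   ex_intro (fun t => t \in T /\ y i = 'P%act (x i) t) t (conj Tt tx)).
apply/imsetP; exists (wr (finfun t) 1).
  by apply: base_sub_N => i; rewrite ffunE.
by apply/ffunP=> i; rewrite /= /aperm wrE ffunE perm1 tx.
Qed.

Lemma wreath_transitive : [transitive G, on [set: X] | 'P].
Proof.
by rewrite (atrans_supgroup N_wreath N_transitive); apply/actsP=> g _ v; rewrite !inE.
Qed.

Lemma coord_stab j t (x : X) :
  t \in T -> t (x j) = x j -> coord_perm j t \in 'C_N[x | 'P].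
Proof.
move=> Tt fix_t; rewrite in_stab (subsetP (coord_N j)) ?coord_in //=.
by apply/eqP/ffunP=> i; rewrite coord_permE; case: eqP => // ->.
Qed.

(** The permutations of the coordinates conjugate the coordinate subgroups to each
    other. *)
Lemma coord_spread (H : {group {perm X}}) j :
  (forall s, wr [ffun=> 1] s \in 'N(H)) -> E j \subset H -> N \subset H.
Proof.
move=> topH sEH; apply: sub_N => i; apply/subsetP=> _ /coordP[t Tt ->].
have := coord_permJ [ffun=> 1] (tperm i j) i t.
rewrite tpermL ffunE conjg1 => <-.
by rewrite memJ_norm // (subsetP sEH) ?coord_in.
Qed.

(** Let [H] contain the stabilizer of a constant point [x0] properly. Up to a
    permutation of coordinates, which fixes [x0], some [wr h 1] in [H] has a
    coordinate [h j] moving [d]. The elements [t] of [T] whose copy at coordinate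
    [j] lies in [H] form a subgroup [A] that contains the stabilizer of [d] and
    its conjugate by [h j]. As [h j] does not
    normalize the stabilizer, [A] is [T] by maximality, so [H] contains the whole
    base group. *)
Lemma wreath_maximal_stab (d : Delta) :
  maximal_eq 'C_G[[ffun=> d] : X | 'P] G.
Proof.
set x0 : X := [ffun=> d].
apply/maximal_eqP; split=> [|H sCH sHG]; first exact: subsetIl.
have topH s : wr [ffun=> 1] s \in H.
  apply: (subsetP sCH); rewrite in_stab top_wreath /=.
  by apply/eqP/ffunP=> i; rewrite wrE !ffunE perm1.
have [sHC | /subsetPn[m Hm nCm]] := boolP (H \subset 'C_G[x0 | 'P]).
  by left; apply/eqP; rewrite eqEsubset sHC.
right; have Gm := subsetP sHG m Hm.
have [h [s [Th def_m]]] := wreathP _ _ Gm.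
have def_m' : m = wr [ffun=> 1] s * wr h 1.
  by rewrite def_m wrM mul1g; congr wr; apply/ffunP=> i; rewrite !ffunE mul1g.
have Hb : wr h 1 \in H.
  by rewrite -(groupMl _ (topH s)) -def_m'.
have [j hjd] : exists j, h j d != d.
  apply/existsP; apply: contraR nCm; rewrite negb_exists => /forallP fixd.
  rewrite in_stab Gm /= def_m; apply/eqP/ffunP=> i; rewrite wrE !ffunE.
  by apply/eqP; have := fixd i; rewrite negbK.
have CH u : u \in 'C_T[d | 'P] -> coord_perm j u \in H.
  rewrite in_stab => /andP[Tu /eqP ud]; apply: (subsetP sCH).
  have : coord_perm j u \in 'C_N[x0 | 'P] by apply: coord_stab; rewrite ?ffunE.
  by apply: subsetP; apply: setSI N_wreath.
pose A := (T :&: e j @*^-1 H)%G.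
have inA t : (t \in A) = (t \in T) && (coord_perm j t \in H).
  by rewrite !inE.
have sEH : E j \subset H.
  have [|| AC | AT] := @maxT d A.
  - by apply/subsetP=> u Cu; rewrite inA CH // (subsetP (subsetIl _ _) u Cu).
  - exact: subsetIl.
  - case/eqP: hjd; apply: norm_stab_fix => //.
    apply/subsetP=> _ /imsetP[u Cu ->]; rewrite -AC inA.
    have Tu := subsetP (subsetIl _ _) u Cu.
    rewrite groupJ //= -(coord_permJ h 1) perm1 groupJ //.
    exact: CH.
  apply/subsetP=> _ /coordP[t Tt ->].
  by have := Tt; rewrite -[T : {set _}]AT inA => /andP[].
have sNH : N \subset H.
  by apply: coord_spread sEH => s'; apply: (subsetP (normG H)).
apply/eqP; rewrite eqEsubset sHG; apply/subsetP=> g Gg.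
have [h' [s' [Th' def_g]]] := wreathP _ _ Gg.
have -> : g = wr [ffun=> 1] s' * wr h' 1.
  by rewrite def_g wrM mul1g; congr wr; apply/ffunP=> i; rewrite !ffunE mul1g.
by rewrite groupM // (subsetP sNH) ?base_sub_N.
Qed.

Lemma wreath_primitive : [primitive G, on [set: X] | 'P].
Proof.
have [d _ _] := imsetP trT.
by rewrite (trans_prim_astab (in_setT ([ffun=> d] : X)) wreath_transitive) wreath_maximal_stab.
Qed.

(** A permutation [c] that commutes with [N] maps [x] to a point whose [i]-th
    coordinate is fixed by the stabilizer of [x i] in [T]; this determines that
    coordinate. *)
Lemma cent_N : 'C(N) = 1.
Proof.
apply/trivgP/subsetP=> c /centP cN; apply/set1P/permP=> x; rewrite perm1.
apply/ffunP=> i; apply/esym/stab_sub_eq/subsetP=> t.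
rewrite !in_stab => /andP[Tt /eqP fix_t]; rewrite Tt /=.
have Et := coord_stab (x := x) Tt fix_t.
move: (Et); rewrite in_stab => /andP[Nt /eqP fix_x].
have := congr1 (fun g : {perm X} => g x i) (cN _ Nt).
by rewrite !permM fix_x coord_permE eqxx => ->.
Qed.

(** As [N] has trivial centralizer, [M] meets it nontrivially, in an element with
    some coordinate [h j != 1]. Its commutator with the copy at [j] of an element
    [u] not commuting with [h j] is a nontrivial element of [M] supported at [j].
    By simplicity of [T], [M] contains the coordinate subgroup at [j], and all
    the others by conjugation. *)
Lemma normal_contains_N (M : {group {perm X}}) : M <| G -> M :!=: 1 -> N \subset M.
Proof.
move=> nsMG ntM; have [sMG nMG] := andP nsMG.
have [sNG nNG] := andP N_normal.
have [m /setIP[Mm Nm] mt] : exists2 m, m \in M :&: N & m != 1.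
  apply/trivgPn; apply: contra ntM => /eqP MN1.
  rewrite -subG1 -cent_N; apply/commG1P/trivgP; rewrite -MN1 subsetI.
  rewrite commg_subl commg_subr; apply/andP; split.
    exact: subset_trans sNG nMG.
  exact: subset_trans sMG nNG.
have [h [Th def_m]] := baseP _ _ (subsetP N_base m Nm).
have [j hj] : exists j, h j != 1.
  apply/existsP; apply: contraR mt; rewrite negb_exists => /forallP h1.
  rewrite def_m -wr1; apply/eqP; congr wr; apply/ffunP=> i; rewrite ffunE.
  by apply/eqP; have := h1 i; rewrite negbK.
have [u Tu ntu] : exists2 u, u \in T & ~~ (h j * u == u * h j).
  apply/exists_inP; apply: contraR hj => /exists_inPn cu.
  by apply/eqP/simple_center => // u Tu; apply/eqP; have := cu u Tu; rewrite negbK.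
pose A := (T :&: e j @*^-1 M)%G.
have inA t : (t \in A) = (t \in T) && (coord_perm j t \in M).
  by rewrite !inE.
have nsAT : A <| T.
  rewrite /normal subsetIl; apply/subsetP=> t Tt; rewrite inE.
  apply/subsetP=> _ /imsetP[a Aa ->]; move: Aa; rewrite !inA => /andP[Ta Ma].
  rewrite groupJ //=; have := morphJ (e j) (in_setT a) (in_setT t) => /= ->.
  by rewrite memJ_norm // (subsetP nMG) ?coord_wreath.
(* The commutator [~ u, h j] belongs to A, which is normal in T. *)
have [_ simT'] := simpleP _ simT.
have ntA : [~ u, h j] \in A.
  rewrite inA groupR //=.
  have -> : coord_perm j [~ u, h j] = [~ coord_perm j u, m].
    rewrite !commgEl def_m -{4}[j](perm1 j) coord_permJ.
    have := morphM (e j) (in_setT u^-1) (in_setT (u ^ h j)) => /= ->.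
    by have := morphV (e j) (in_setT u) => /= ->.
  rewrite commgEr groupM // memJ_norm ?groupV //.
  by rewrite (subsetP nMG) ?coord_wreath.
have [A1 | AT] := simT' _ nsAT.
  have /set1P/eqP/commgP cu : [~ u, h j] \in [1 {perm Delta}] by rewrite -A1.
  by case/negP: ntu; apply/eqP/esym/cu.
apply: (@coord_spread _ j).
  by move=> s; rewrite (subsetP nMG) ?top_wreath.
apply/subsetP=> _ /coordP[t Tt ->].
by have := Tt; rewrite -[T : {set _}]AT inA => /andP[].
Qed.

Lemma wreath_quasiprimitive : quasiprimitive G.
Proof.
split=> [|M nsMG ntM]; first exact: wreath_transitive.
rewrite (atrans_supgroup (normal_contains_N nsMG ntM) N_transitive).
by apply/actsP=> g _ v; rewrite !inE.
Qed.

Definition coord_fix i : {set {perm X}} := [set g : {perm X} | [forall x : X, g x i == x i]].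

Lemma coord_fixP i (g : {perm X}) : reflect (forall x : X, g x i = x i) (g \in coord_fix i).
Proof. by rewrite inE; apply: (iffP forallP) => h x; apply/eqP. Qed.

Lemma coord_fix_group i : group_set (coord_fix i).
Proof.
apply/group_setP; split=> [|g h /coord_fixP fg /coord_fixP fh]; apply/coord_fixP=> x.
  by rewrite perm1.
by rewrite permM fh fg.
Qed.

Lemma others_coord_fix i : (\prod_(j < l | j != i) E j)%G \subset coord_fix i.
Proof.
rewrite bigprodGE -[coord_fix i]/(gval (Group (coord_fix_group i))) gen_subG.
apply/bigcupsP=> j neq_ji; apply/subsetP=> _ /coordP[t Tt ->].
by apply/coord_fixP=> x; rewrite coord_permE eq_sym (negPf neq_ji).
Qed.

Lemma N_dprod : \big[dprod/1]_(j < l) E j = N.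
Proof.
apply/eqP/bigdprodYP => i _ /=; apply/subsetP=> g Kg; rewrite !inE negb_and negbK.
apply/andP; split.
  have [-> | ntg] := eqVneq g 1; first by [].
  apply: contra ntg => /coordP[t Tt def_g]; apply/eqP; rewrite def_g.
  suff -> : t = 1 by exact: (morph1 (e i)).
  have /coord_fixP fixg := subsetP (others_coord_fix i) g Kg.
  apply/permP=> z; have := fixg [ffun=> z].
  by rewrite def_g coord_permE eqxx ffunE perm1.
move: g Kg; apply/subsetP; rewrite bigprodGE gen_subG; apply/bigcupsP=> j neq_ji.
apply/centsP=> _ /coordP[t Tt ->] _ /coordP[u Tu ->].
apply/permP=> x; apply/ffunP=> k; rewrite !permM !coord_permE.
by case: (eqVneq k i) => [-> | //]; rewrite eq_sym (negPf neq_ji).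
Qed.

Lemma N_unique_minimal : (0 < l)%N -> unique_minimal_normal N G.
Proof.
move=> l0; have [sNG nNG] := andP N_normal.
have ntN : N :!=: 1.
  apply: contra nabT => /eqP N1; have := injm_abelian (injm_coord (Ordinal l0)) (subsetT T).
  by move=> <-; apply: abelianS (coord_N (Ordinal l0)) _; rewrite N1 abelian1.
split=> // [|M sMG minM].
  apply/mingroupP; split=> [|M /andP[ntM nMG] sMN]; first by rewrite ntN.
  apply/eqP; rewrite eqEsubset sMN normal_contains_N // /normal nMG andbT.
  exact: subset_trans sMN sNG.
have [/andP[ntM nMG] minM'] := mingroupP minM.
apply/group_inj/esym/minM'; rewrite ?ntN //.
by apply: normal_contains_N; rewrite // /normal sMG.
Qed.

(** An element of [N] fixing [x] has its [i]-th coordinate in the stabilizer of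
    [x i], which is a proper subgroup of [T]; so its projection to the [i]-th
    factor fixes [x] too. *)
Theorem wreath_PA : (2 <= l)%N -> PA_type G.
Proof.
move=> l2; split; first exact: wreath_quasiprimitive.
exists l, N, E; split=> //.
- by apply: N_unique_minimal; apply: leq_trans l2.
- exact: N_dprod.
- split=> [i | i j].
    rewrite -(isog_simple (sub_isog (subsetT T) (injm_coord i))).
    by rewrite (injm_abelian (injm_coord i)) ?subsetT.
  have isoE (k : 'I_l) : T \isog E k := sub_isog (subsetT T) (injm_coord k).
  by apply: isog_trans (isoE j); rewrite isog_sym.
move=> x; split=> [|i].
  pose i0 := Ordinal (leq_trans (isT : 0 < 2)%N l2).
  have [t Ct ntt] := trivgPn _ (stabT (x i0)).
  move: Ct; rewrite in_stab => /andP[Tt /eqP fix_t].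
  apply/trivgPn; exists (coord_perm i0 t); first exact: coord_stab.
  by rewrite -(morph1 (e i0)) (inj_in_eq (injmP (injm_coord i0))) ?inE.
have dN := dprod_complement_factor N_dprod i.
have [_ defKE _ trKE] := dprodP dN.
set K := (\prod_(j < l | j != i) E j)%G in dN defKE trKE *.
have [t Tt tx] := stab_moves (x i).
apply: (@sub_proper_trans _ _ (mem [set g in E i | g x i == x i])).
  apply/subsetP=> _ /imsetP[n Cn ->]; move: Cn; rewrite in_stab => /andP[Nn /eqP fix_n].
  have KEn : n \in K * E i by rewrite defKE.
  rewrite inE mem_remgr //=.
  have /coordP[u Tu def_r] := mem_remgr KEn.
  have /coord_fixP fixd := subsetP (others_coord_fix i) _ (mem_divgr KEn).
  have : (divgr K (E i) n * remgr K (E i) n) x i = x i by rewrite -divgr_eq fix_n.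
  by rewrite permM def_r !coord_permE eqxx fixd => ->.
apply/properP; split; first by apply/subsetP=> g /setIdP[].
exists (coord_perm i t); first exact: coord_in.
by rewrite inE coord_permE eqxx (negPf tx) andbF.
Qed.

End ProductPrimitive.

(** In [R * S] the base component [r] has to be moved past the permutation [s],
    hence the reindexing by [s^-1] in the last step. *)
Theorem product_action_factorized (Delta : finType) (l : nat)
    (T R S : {group {perm Delta}}) :
  (2 <= l)%N -> ekr_factorized T R S ->
  primitive_in_product_action (wreath l T) /\
  exists R' S' : {group {perm {ffun 'I_l -> Delta}}},
    [/\ R' \subset wreath l T, semiregular_perm R',
        intersecting (wreath l T) S', wreath l T = R' * S' :> {set _}
      & #|R'| = (#|R| ^ l)%N].
Proof.
move=> l2 [primT simT nabT stabT sRT srR sST fixS defT]; split.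
  split; [exact: wreath_primitive | exact: wreath_PA | exact: wreath_sub_product_action].
have [d _ _] := imsetP (proj1 (andP primT)).
exists (base l R), (wreath l S).
have sSG : wreath l S \subset wreath l T.
  apply/subsetP=> _ /wreathP[h [s [Sh ->]]]; apply/wreathP; exists h, s.
  by split=> // i; apply: (subsetP sST).
have sRG : base l R \subset wreath l T.
  apply/subsetP=> _ /baseP[h [Rh ->]]; apply/wreathP; exists h, 1.
  by split=> // i; apply: (subsetP sRT).
split=> //; last exact: card_base d.
- move=> _ /baseP[h [Rh ->]] x /ffunP fixx; rewrite -wr1; congr wr.
  apply/ffunP=> i; rewrite ffunE; apply: (srR _ _ (x i)) => //.
  by have := fixx i; rewrite wrE perm1.
- apply/intersectingP; split=> // x y Sx Sy.
  by apply: (wreath_fixed_point fixS); rewrite groupM ?groupV.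
apply/eqP; rewrite eqEsubset mul_subG // andbT; apply/subsetP=> g.
case/wreathP=> h [s [Th ->]].
have split_h i : exists2 r, r \in R & exists2 b, b \in S & h i = r * b.
  have : h i \in R * S by rewrite -defT.
  by case/mulsgP=> r b Rr Sb ->; exists r => //; exists b.
have [r Rr /fin_all_exists2[b Sb def_h]] := fin_all_exists2 split_h.
apply/mulsgP; exists (wr [ffun i => r (s^-1 i)] 1) (wr (finfun b) s).
- by apply/baseP; eexists; split; last by []; move=> i; rewrite ffunE.
- by apply/wreathP; do 2!eexists; split; last by []; move=> i; rewrite ffunE.
by rewrite wrM mulg1; congr wr; apply/ffunP=> i; rewrite !ffunE permK def_h.
Qed.

(** * Estimates and the two families *)

Section Estimates.
Variable K : realType.
Local Open Scope ring_scope.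

Local Notation a := (Num.sqrt 2 / 2 : K).

Lemma half_sqrt2_sqr : a ^+ 2 = 1 / 2.
Proof. by rewrite expr_div_n sqr_sqrtr //; field. Qed.

Lemma half_sqrt2_gt0 : 0 < a.
Proof. by rewrite divr_gt0 ?sqrtr_gt0. Qed.

Lemma half_sqrt2_bounds : 1 / 2 < a < 1.
Proof.
have := half_sqrt2_sqr; have := half_sqrt2_gt0; set x : K := Num.sqrt 2 / 2.
by move=> x0 x2; apply/andP; split; nra.
Qed.

(** Here [r ^ 2 = 1 / 2 - 1 / (2 (q + 1))]. The lower bound follows from
    [(a - r) (a + r) = 1 / (2 (q + 1))] with [a = sqrt 2 / 2 > 1 / 2]. *)
Lemma pair_ratio_bounds (D q : nat) (r := Num.sqrt (D%:R : K) / q.+1%:R) :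
  (0 < q)%N -> (D * 2 = q.+1 * q)%N ->
  [/\ 0 <= r, r < a & a - r < q.+1%:R^-1].
Proof.
move=> q0 eqD; have r0 : 0 <= r by rewrite divr_ge0 ?sqrtr_ge0.
have [a2 a0 /andP[a_half _]] := And3 half_sqrt2_sqr half_sqrt2_gt0 half_sqrt2_bounds.
set Q := q.+1%:R : K in r r0 *.
have Q0 : 0 < Q by rewrite ltr0n.
have Qn : Q != 0 by rewrite gt_eqF.
have r2 : r ^+ 2 = 1 / 2 - Q^-1 / 2.
  have eqD' : D%:R * 2 = Q * (Q - 1) :> K.
    by rewrite -natrM eqD natrM /Q -[X in _ = _ * (X - 1)]natr1 addrK.
  rewrite expr_div_n sqr_sqrtr ?ler0n //.
  have -> : D%:R = Q * (Q - 1) / 2 :> K by rewrite -eqD' mulfK ?pnatr_eq0.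
  by field; rewrite addrC natr1.
have iQ : 0 < Q^-1 by rewrite invr_gt0.
clearbody r; move: r2 a2 a_half a0 r0 iQ; set i := Q^-1.
set x : K := Num.sqrt 2 / 2.
move=> r2 x2 x_half x0 r0 i0; split=> //; first by nra.
by nra.
Qed.

Lemma expr_sub_bound (x y : K) l : 0 <= y -> y <= x -> x <= 1 ->
  x ^+ l - y ^+ l <= l%:R * (x - y).
Proof.
move=> y0 yx x1; have x0 := le_trans y0 yx.
elim: l => [|l IHl]; first by rewrite subrr mul0r.
have yl1 : y ^+ l <= 1 by rewrite exprn_ile1 // (le_trans yx).
have yl0 : 0 <= y ^+ l by rewrite exprn_ge0.
rewrite !exprS -natr1 mulrDl mul1r.
have -> : x * x ^+ l - y * y ^+ l = x * (x ^+ l - y ^+ l) + (x - y) * y ^+ l by ring.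
apply: lerD.
  apply: le_trans IHl; rewrite ler_piMl // subr_ge0.
  by apply: lerXn2r.
by rewrite ler_piMr // subr_ge0.
Qed.

Lemma large_power (l : nat) (eps : K) : 0 < eps ->
  exists n0 : nat, forall n, l%:R * ((2 ^ (n0 + n).+2).+1%:R)^-1 < eps.
Proof.
move=> eps0; exists (Num.truncn (l%:R / eps)) => n.
rewrite ltr_pdivrMr ?ltr0n // mulrC -ltr_pdivrMr //.
apply: lt_le_trans (truncnS_gt _) _; rewrite ler_nat ltnS.
apply: leq_trans _ (ltnW (ltn_expl _ (ltnSn 1))).
by rewrite -addn2 -addnA leq_addr.
Qed.

End Estimates.

Section Family.

Variable f : nat.

Let q := (2 ^ f.+2)%N.

Definition even_field : finFieldType :=
  s2val (pPrimePowerField (isT : prime 2) (isT : (0 < f.+2)%N)).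

Lemma card_even_field : #|even_field| = q.
Proof. exact: (s2valP' (pPrimePowerField (isT : prime 2) (isT : (0 < f.+2)%N))). Qed.

Definition line_pairs : finType := pairs (option even_field).

Definition line_group : {group {perm line_pairs}} :=
  (pair_morphism (option even_field) @* moebius_group even_field)%G.

Lemma line_group_factorized : exists R S : {group {perm line_pairs}},
  ekr_factorized line_group R S /\ #|R| = q.+1.
Proof.
have [R [S [factRS cardR]]] := moebius_pairs_factorized card_even_field.
by exists R, S; split; rewrite // cardR card_even_field.
Qed.

Lemma card_line_pairs : (#|line_pairs| * 2 = q.+1 * q)%N.
Proof.
have -> : #|line_pairs| = 'C(q.+1, 2).
  rewrite card_sig -card_even_field -card_option -card_draws.
  by apply: eq_card => A; rewrite !inE.
by rewrite -[2 in LHS]/(2`!) bin_ffact ffactSS ffactn1.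
Qed.

End Family.

(** The number of pairs determines [q] because [(q + 1) q] increases with [q]; this
    separates the members of the two families up to permutation isomorphism. *)
Lemma line_pairs_inj : injective (fun f => #|line_pairs f|).
Proof.
move=> m n /= eq_mn.
have : ((2 ^ m.+2).+1 * 2 ^ m.+2 = (2 ^ n.+2).+1 * 2 ^ n.+2)%N.
  by rewrite -!card_line_pairs eq_mn.
set a := (2 ^ m.+2)%N; set b := (2 ^ n.+2)%N => eq_q.
suff /eqP : a = b by rewrite eqn_exp2l // !eqSS => /eqP.
have [lt_ab | lt_ba | //] := ltngtP a b.
  by have := @ltn_mul a.+1 a b.+1 b lt_ab lt_ab; rewrite eq_q ltnn.
by have := @ltn_mul b.+1 b a.+1 a lt_ba lt_ba; rewrite eq_q ltnn.
Qed.

Lemma perm_isomorphic_card (O1 O2 : finType) (G1 : {group {perm O1}}) (G2 : {group {perm O2}}) :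
  perm_isomorphic G1 G2 -> #|O1| = #|O2|.
Proof. by case=> h [phi [bij_h _ _]]; exact: bij_eq_card bij_h. Qed.

Theorem theorem1p3 (K : realType) :
  (forall (Omega : finType) (G : {group {perm Omega}}),
     quasiprimitive G ->
     ((exists2 R : {group {perm Omega}}, R \subset G & regular_perm R)
        /\ EKR_property G)
     \/ (almost_simple G \/ PA_type G))
  /\
  (forall eps : K, (0 < eps)%R ->
     exists (Omega : nat -> finType) (G : forall n, {group {perm (Omega n)}}),
       (forall m n, perm_isomorphic (G m) (G n) -> m = n) /\
       forall n,
         [/\ [primitive (G n), on [set: Omega n] | 'P],
             simple (G n), ~~ abelian (G n),
             exists (R : {group {perm (Omega n)}}) (S : {set {perm (Omega n)}}),
               [/\ R \subset G n, semiregular_perm R,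
                   maximum_intersecting (G n) S & G n = R * S :> {set _}]
           & forall w : Omega n,
               (Num.sqrt 2 / 2 - eps < rho K (G n) w < Num.sqrt 2 / 2)%R])
  /\
  (forall (l : nat) (eps : K), (2 <= l)%N -> (0 < eps)%R ->
     exists (Delta : nat -> finType)
            (G : forall n, {group {perm {ffun 'I_l -> Delta n}}}),
       (forall m n, perm_isomorphic (G m) (G n) -> m = n) /\
       forall n,
         [/\ primitive_in_product_action (G n),
             exists (R : {group {perm {ffun 'I_l -> Delta n}}})
                    (S : {set {perm {ffun 'I_l -> Delta n}}}),
               [/\ R \subset G n, semiregular_perm R,
                   maximum_intersecting (G n) S & G n = R * S :> {set _}]
           & forall w : {ffun 'I_l -> Delta n},
               ((Num.sqrt 2 / 2) ^+ l - eps < rho K (G n) w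
                  < (Num.sqrt 2 / 2) ^+ l)%R]).
Proof.
split; [|split].
- move=> Omega G qpG; have [trG _] := qpG.
  have [[R sRG regR] | ?] := quasiprimitive_dichotomy qpG; last by right.
  by left; split; [exists R | exact: regular_EKR sRG regR].
- move=> eps eps0; have [n0 large] := large_power 1 eps0.
  exists (fun n => line_pairs (n0 + n)), (fun n => line_group (n0 + n)); split.
    move=> m n /perm_isomorphic_card /line_pairs_inj /eqP.
    by rewrite eqn_add2l => /eqP.
  move=> n; have [R [S [fact cardR]]] := line_group_factorized (n0 + n).
  have [primT simT nabT _ sRT srR sST fixS defT] := fact.
  have intS : intersecting (line_group (n0 + n)) S.
    apply/intersectingP; split=> // x y Sx Sy.
    by apply: fixS; rewrite groupM ?groupV.
  split=> //.
    exists R, S; split=> //; exact: factorization_maximum sRT srR intS defT.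
  move=> w; rewrite (rho_factorization K w (proj1 (andP primT)) sRT srR intS defT) cardR.
  have [_ lt_a gt_a] := pair_ratio_bounds K (expn_gt0 2 _) (card_line_pairs (n0 + n)).
  rewrite lt_a andbT ltrBlDr -ltrBlDl; apply: lt_trans gt_a _.
  by have := large n; rewrite mul1r.
move=> l eps l2 eps0; have [n0 large] := large_power l eps0.
exists (fun n => line_pairs (n0 + n)), (fun n => wreath l (line_group (n0 + n))); split.
  move=> m n /perm_isomorphic_card; rewrite !card_ffun !card_ord => /eqP.
  rewrite eqn_exp2r ?(ltnW l2) // => /eqP /line_pairs_inj /eqP.
  by rewrite eqn_add2l => /eqP.
move=> n; have [R [S [fact cardR]]] := line_group_factorized (n0 + n).
have [primG [R' [S' [sRG srR intS defG cardR']]]] := product_action_factorized l2 fact.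
split=> //.
  exists R', S'; split=> //; exact: factorization_maximum sRG srR intS defG.
have [primG' _ _] := primG.
move=> w; rewrite (rho_factorization K w (proj1 (andP primG')) sRG srR intS defG).
rewrite cardR' cardR card_ffun card_ord !natrX.
have -> : (Num.sqrt (#|line_pairs (n0 + n)|%:R ^+ l) =
           Num.sqrt #|line_pairs (n0 + n)|%:R ^+ l :> K)%R.
  elim: (l) => [|k IHk]; first by rewrite !expr0 sqrtr1.
  by rewrite !exprS sqrtrM ?ler0n // IHk.
rewrite -expr_div_n.
have [r0 lt_a gt_a] := pair_ratio_bounds K (expn_gt0 2 _) (card_line_pairs (n0 + n)).
apply/andP; split; last by rewrite ltrXn2r // -lt0n (ltnW l2).
rewrite ltrBlDr -ltrBlDl.
have /andP[_ /ltW a1] := half_sqrt2_bounds K.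
apply: le_lt_trans (expr_sub_bound l r0 (ltW lt_a) a1) _.
apply: le_lt_trans (large n).
by rewrite ler_wpM2l ?ler0n // ltW.
Qed.
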